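(* Let $\mathcal{A}:\mathbb{M}_{n_1,n_2}\to\mathbb{F}^m$ be linear, let $b\in\mathbb{F}^m$, let $1\le K<\min(n_1,n_2)$ be an integer, and set $$\mathcal{R}_{K,reg}(X)=\mathcal{Q}_2(\iota_{R_K})(X)+\|\mathcal{A}X-b\|^2,\qquad X\in\mathbb{M}_{n_1,n_2}.$$ Let $X'$ be a stationary point of $\mathcal{R}_{K,reg}$ with $\mathrm{rank}(X')\le K$, let $$Z'=(I-\mathcal{A}^*\mathcal{A})X'+\mathcal{A}^*b,$$ and assume that $$\sigma_{K+1}(Z')<(1-2\delta_{2K}^-)\,\sigma_K(Z').$$ Then there are no other stationary points of $\mathcal{R}_{K,reg}$ with rank less than or equal to $K$.
   Context: $\mathbb{F}$ is $\mathbb{R}$ or $\mathbb{C}$, and $\mathbb{M}_{n_1,n_2}$ is the space of $n_1\times n_2$ matrices with entries in $\mathbb{F}$. Norms of matrices are Frobenius norms, norms of vectors are $\ell^2$-norms, and $\mathcal{A}^*$ is the adjoint of $\mathcal{A}$ with respect to the corresponding inner products. $\sigma_1(X)\ge\dots\ge\sigma_n(X)\ge 0$, $n=\min(n_1,n_2)$, are the singular values of $X$. $R_K=\{X\in\mathbb{M}_{n_1,n_2}:\mathrm{rank}(X)\le K\}$, and $\iota_{R_K}(X)=0$ if $X\in R_K$, $\iota_{R_K}(X)=\infty$ otherwise. For a functional $F$ on an inner product space $\mathcal{V}$, the quadratic envelope is $\mathcal{Q}_2(F)=\mathcal{S}_2(\mathcal{S}_2(F))$, where $\mathcal{S}_2(F)(Y)=\sup_{X\in\mathcal{V}}\big(-F(X)-\|X-Y\|^2\big)$;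 equivalently, for lower semicontinuous $[0,\infty]$-valued $F$, $\mathcal{Q}_2(F)(X)+\|X\|^2$ is the lower semicontinuous convex envelope of $F(X)+\|X\|^2$. The lower restricted isometry constant $\delta_{J}^-$ of $\mathcal{A}$ is defined, for an integer $J\ge1$, by $$1-\delta_J^-=\inf\left\{\frac{\|\mathcal{A}X\|^2}{\|X\|^2}: X\in\mathbb{M}_{n_1,n_2},\ X\ne 0,\ \mathrm{rank}(X)\le J\right\}.$$ A point $X$ is stationary for a functional $g$ if $\liminf_{Y\to X,\,Y\ne X}\frac{g(Y)-g(X)}{\|Y-X\|}\ge 0$. *)

(* Defs.v *)
From mathcomp Require Import all_boot all_order all_algebra.
From mathcomp Require Import all_classical all_reals all_analysis.
From mathcomp Require Import complex.

Set Implicit Arguments.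
Unset Strict Implicit.
Unset Printing Implicit Defensive.

Import Order.TTheory GRing.Theory Num.Theory.
Import numFieldNormedType.Exports.
Local Open Scope classical_set_scope.
Local Open Scope ring_scope.

Variant real_or_complex := RealScalars | ComplexScalars.

Definition scal (R : realType) (k : real_or_complex) : numFieldType :=
  match k with
  | RealScalars => (R : numFieldType)
  | ComplexScalars => (R[i] : numFieldType)
  end.

Definition conjs (R : realType) (k : real_or_complex) : scal R k -> scal R k :=
  match k return scal R k -> scal R k with
  | RealScalars => fun x => x
  | ComplexScalars => fun z => conjc (z : R[i])
  end.

(* The modulus, with values in [R] also for complex scalars (the library norm
   of [R[i]] is [R[i]]-valued). *)
Definition modulus (R : realType) (k : real_or_complex) : scal R k -> R :=
  match k return scal R k -> R with
  | RealScalars => fun x => `|(x : R)|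
  | ComplexScalars => fun z => ComplexField.Normc.normc (z : R[i])
  end.

Definition to_complex (R : realType) (k : real_or_complex) : scal R k -> R[i] :=
  match k return scal R k -> R[i] with
  | RealScalars => fun x => real_complex R x
  | ComplexScalars => fun z => z
  end.

(* Frobenius inner product and norm; on ['cV_m] = ['M_(m, 1)] they are the l2
   inner product and norm. *)
Definition inner (R : realType) (k : real_or_complex) (p q : nat)
    (X Y : 'M[scal R k]_(p, q)) : scal R k :=
  \sum_(i < p) \sum_(j < q) X i j * conjs (Y i j).

Definition fnorm (R : realType) (k : real_or_complex) (p q : nat)
    (X : 'M[scal R k]_(p, q)) : R :=
  Num.sqrt (\sum_(i < p) \sum_(j < q) modulus (X i j) ^+ 2).

(* The (i, j) entry of [adj A y] is <y, A E_ij>, with E_ij the matrix unit;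
   see [adjP]. *)
Definition adj (R : realType) (k : real_or_complex) (n1 n2 m : nat)
    (A : {linear 'M[scal R k]_(n1, n2) -> 'cV[scal R k]_m})
    (y : 'cV[scal R k]_m) : 'M[scal R k]_(n1, n2) :=
  \matrix_(i < n1, j < n2) inner y (A (delta_mx i j)).

(* [singval X i] is sigma_i(X) for 1 <= i <= min(n1, n2), numbered from 1: the
   i-th largest square root of an eigenvalue (with multiplicity) of the
   Hermitian matrix X^* X. *)
Definition singvals (R : realType) (k : real_or_complex) (n1 n2 : nat)
    (X : 'M[scal R k]_(n1, n2)) : seq R :=
  let Y : 'M[R[i]]_(n1, n2) := map_mx (@to_complex R k) X in
  let G : 'M[R[i]]_n2 := (Y^t* *m Y)%sesqui in
  sort >=%R [seq Num.sqrt (complex.Re (spectral_diag G 0 j)) | j <- enum 'I_n2].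

Definition singval (R : realType) (k : real_or_complex) (n1 n2 : nat)
    (X : 'M[scal R k]_(n1, n2)) (i : nat) : R :=
  nth 0 (singvals X) i.-1.

Definition rank_le (R : realType) (k : real_or_complex) (n1 n2 K : nat) :
    set 'M[scal R k]_(n1, n2) :=
  [set X | (\rank X <= K)%N].

Definition indic_fun (R : realType) (T : Type) (S : set T) (x : T) : \bar R :=
  if `[< S x >] then 0%E else +oo%E.

Definition S2 (R : realType) (k : real_or_complex) (n1 n2 : nat)
    (F : 'M[scal R k]_(n1, n2) -> \bar R) (Y : 'M[scal R k]_(n1, n2)) :
    \bar R :=
  ereal_sup (range (fun X => - F X - (fnorm (X - Y) ^+ 2)%:E)%E).

Definition Q2 (R : realType) (k : real_or_complex) (n1 n2 : nat)
    (F : 'M[scal R k]_(n1, n2) -> \bar R) : 'M[scal R k]_(n1, n2) -> \bar R :=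
  S2 (S2 F).

Definition RKreg (R : realType) (k : real_or_complex) (n1 n2 m K : nat)
    (A : {linear 'M[scal R k]_(n1, n2) -> 'cV[scal R k]_m})
    (b : 'cV[scal R k]_m) (X : 'M[scal R k]_(n1, n2)) : \bar R :=
  (Q2 (indic_fun R (@rank_le R k n1 n2 K)) X + (fnorm (A X - b) ^+ 2)%:E)%E.

Definition lower_ric (R : realType) (k : real_or_complex) (n1 n2 m : nat)
    (A : {linear 'M[scal R k]_(n1, n2) -> 'cV[scal R k]_m}) (J : nat) : R :=
  1 - inf [set fnorm (A X) ^+ 2 / fnorm X ^+ 2 |
            X in [set X | X != 0 /\ (\rank X <= J)%N]].

Definition stationary (R : realType) (k : real_or_complex) (n1 n2 : nat)
    (g : 'M[scal R k]_(n1, n2) -> \bar R) (X : 'M[scal R k]_(n1, n2)) : Prop :=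
  (0 <= limf_einf (fun Y => (g Y - g X) * ((fnorm (Y - X))^-1)%:E) X^')%E.

Lemma adjP (R : realType) (k : real_or_complex) (n1 n2 m : nat)
    (A : {linear 'M[scal R k]_(n1, n2) -> 'cV[scal R k]_m})
    (X : 'M[scal R k]_(n1, n2)) (y : 'cV[scal R k]_m) :
  inner (A X) y = inner X (adj A y).
Proof.
have cM (u v : scal R k) : conjs (u * v) = conjs u * conjs v.
  by case: k A X y u v => //= A X y u v; rewrite rmorphM.
have cK (u : scal R k) : conjs (conjs u) = u.
  by case: k A X y u {cM} => //= A X y u; rewrite conjcK.
have c0 : conjs (0 : scal R k) = 0.
  by case: k A X y {cM cK} => //= A X y; apply: (rmorph0 (@conjc R)).
have cD (u v : scal R k) : conjs (u + v) = conjs u + conjs v.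
  by case: k A X y u v {cM cK c0} => //= A X y u v; apply: (rmorphD (@conjc R)).
have cS (p : nat) (F : 'I_p -> scal R k) :
    conjs (\sum_(i < p) F i) = \sum_(i < p) conjs (F i).
  exact: (big_morph _ cD c0).
rewrite {1}(matrix_sum_delta X) linear_sum /inner.
transitivity (\sum_(i < n1) \sum_(j < n2)
    \sum_(l < m) X i j * (A (delta_mx i j) l 0 * conjs (y l 0))).
  under eq_bigr => l _ do rewrite big_ord1 summxE big_distrl /=.
  rewrite exchange_big; apply: eq_bigr => i _ /=.
  under eq_bigr => l _ do rewrite linear_sum summxE big_distrl /=.
  rewrite exchange_big; apply: eq_bigr => j _ /=; apply: eq_bigr => l _.
  by rewrite linearZ mxE mulrA.
apply: eq_bigr => i _; apply: eq_bigr => j _; rewrite mxE cS big_distrr /=.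
by apply: eq_bigr => l _; rewrite big_ord1 cM cK [conjs _ * _]mulrC.
Qed.

(* Main.v *)
(** If [X] is stationary with rank <= K, the directional derivative of the
    functional towards any [W] of rank <= K shows that [X] is a best rank-K
    approximation of [Z = X - A^*A X + A^*b].  Hence [X = U D V^*] and
    [Z = X + N], where [N] vanishes against [U] and [V] and its operator norm is
    at most every entry of [D]; [sigma_K(Z)] and [sigma_{K+1}(Z)] are then
    respectively a lower bound of [D] and (given a gap) an upper bound of [N].
    For two stationary points, [|A(X'' - X')|^2 = Re<N', X''> + Re<N'', X'>],
    which is at least [(1 - delta)|X'' - X'|^2].  Expanding both sides in the
    two singular bases, with the weights
    [w_ij = (|<u'_i, u''_j>|^2 + |<v'_i, v''_j>|^2) / 2], whose row and column
    sums are at most 1, reduces the contradiction to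
    [(1 - delta)(x^2 + y^2) - r y - x y > 0] for [x > 0], [y >= 0] and
    [r < (1 - 2 delta) x]. *)

Require Import Defs.
From mathcomp Require Import all_boot all_order all_algebra.
From mathcomp Require Import all_classical all_reals all_analysis.
From mathcomp Require Import complex.
From mathcomp Require Import ring lra zify.
Import Order.TTheory GRing.Theory Num.Theory.
Import numFieldNormedType.Exports.
Local Open Scope ring_scope.

Set Implicit Arguments.
Unset Strict Implicit.
Unset Printing Implicit Defensive.

(** * A weighted inequality between two families of singular values *)

(* The row and column defects [b i] and [a j] of [w] have the same total [T];
   multiplying by [T] turns every single sum into a sum over pairs with weights
   [a j * b i]. *)
Lemma coupling_bound (R : realFieldType) (K : nat) (d r n1 n2 : R)
    (s t : 'I_K -> R) (w mu : 'I_K -> 'I_K -> R) :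
  0 < d -> 0 <= r ->
  (forall i, 0 < s i) -> (forall j, 0 <= t j) ->
  (forall i, r < (2 * d - 1) * s i) ->
  (forall i j, mu i j <= w i j) ->
  (forall i, \sum_j w i j <= 1) -> (forall j, \sum_i w i j <= 1) ->
  (forall i j, 0 <= w i j) ->
  n1 <= r * \sum_j (1 - \sum_i w i j) * t j ->
  (forall j, n2 <= t j * \sum_i (1 - \sum_j w i j) * s i) ->
  let e := \sum_i s i ^+ 2 + \sum_j t j ^+ 2
           - 2 * \sum_i \sum_j s i * t j * mu i j in
  d * e <= n1 + n2 -> e <= 0.
Proof.
move=> d0 r0 s0 t0 rs muw wr wc w0 Hn1 Hn2 e Hde.
pose a j := 1 - \sum_i w i j; pose b i := 1 - \sum_j w i j.
have a0 j : 0 <= a j by rewrite subr_ge0.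
have b0 i : 0 <= b i by rewrite subr_ge0.
pose T := \sum_j a j.
have Tb : T = \sum_i b i.
  by rewrite /T /a /b !sumrB; congr (_ - _); rewrite exchange_big.
have T0 : 0 <= T by exact: sumr_ge0.
(* Once each square is split into its defect part and its [w]-part, the remainder is the sum of [w i
   j * (s i ^+ 2 + t j ^+ 2) - 2 * (s i * t j * mu i j)], nonnegative since [mu <= w] and
   [(s i - t j) ^+ 2 >= 0]. *)
have dge : d * (\sum_i b i * s i ^+ 2 + \sum_j a j * t j ^+ 2) <= d * e.
  rewrite ler_pM2l // /e.
  have -> : \sum_i s i ^+ 2 =
      \sum_i b i * s i ^+ 2 + \sum_i \sum_j w i j * s i ^+ 2.
    rewrite -big_split; apply: eq_bigr => i _ /=; rewrite -mulr_suml /b; ring.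
  have -> : \sum_j t j ^+ 2 =
      \sum_j a j * t j ^+ 2 + \sum_i \sum_j w i j * t j ^+ 2.
    rewrite [X in _ + X]exchange_big -big_split; apply: eq_bigr => j _ /=.
    rewrite -mulr_suml /a; ring.
  rewrite -subr_ge0.
  rewrite (_ : _ - _ = \sum_i \sum_j
    (w i j * s i ^+ 2 + w i j * t j ^+ 2 - 2 * (s i * t j * mu i j))); last first.
    under [in RHS]eq_bigr do rewrite sumrB big_split /= -mulr_sumr.
    rewrite sumrB big_split /= -mulr_sumr; ring.
  apply: sumr_ge0 => i _; apply: sumr_ge0 => j _.
  have := sqr_ge0 (s i - t j).
  have : s i * t j * mu i j <= s i * t j * w i j.
    by rewrite ler_wpM2l // mulr_ge0 // ltW.
  have := w0 i j; nra.
case: (eqVneq T 0) => [T00|Tn0]; last first.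
  have Tp : 0 < T by rewrite lt_neqAle eq_sym Tn0.
  exfalso.
  have Tn2 : T * n2 <= \sum_j \sum_i a j * b i * (t j * s i).
    rewrite {1}/T mulr_suml ler_sum // => j _.
    have -> : \sum_i a j * b i * (t j * s i) = a j * (t j * \sum_i b i * s i).
      by rewrite !mulr_sumr; apply: eq_bigr => i _; ring.
    by rewrite ler_wpM2l.
  have h1 : T * (d * (\sum_i b i * s i ^+ 2 + \sum_j a j * t j ^+ 2)) =
     \sum_j \sum_i a j * b i * (d * (s i ^+ 2 + t j ^+ 2)).
    have -> : T * (d * (\sum_i b i * s i ^+ 2 + \sum_j a j * t j ^+ 2)) =
       \sum_j (a j * (d * \sum_i b i * s i ^+ 2) + a j * (d * t j ^+ 2 * T)).
      rewrite big_split /= -!mulr_suml -/T mulrDr mulrDr; congr (_ + _).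
      rewrite !mulr_sumr; apply: eq_bigr => j _; ring.
    apply: eq_bigr => j _; rewrite Tb !mulr_sumr -big_split /=.
    by apply: eq_bigr => i _; ring.
  have h2 : T * n1 <= \sum_j \sum_i a j * b i * (r * t j).
    have -> : \sum_j \sum_i a j * b i * (r * t j) = T * (r * \sum_j a j * t j).
      rewrite Tb !mulr_sumr; apply: eq_bigr => j _; rewrite !mulr_suml.
      by apply: eq_bigr => i _; ring.
    by rewrite ler_pM2l.
  have h3 : \sum_j \sum_i a j * b i * (d * (s i ^+ 2 + t j ^+ 2)) <=
    \sum_j \sum_i a j * b i * (r * t j) + \sum_j \sum_i a j * b i * (t j * s i).
    rewrite -h1 (le_trans _ (lerD h2 Tn2)) // -mulrDr ler_pM2l //.
    exact: le_trans dge Hde.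
  (* For [t j > 0], replacing [r] by the larger [(2 * d - 1) * s i] turns the bracket into
     [d * (s i - t j) ^+ 2]. *)
  have br i j : 0 < d * (s i ^+ 2 + t j ^+ 2) - r * t j - t j * s i.
    have := s0 i; have := t0 j; rewrite le_eqVlt => /orP[/eqP<-|tj] si.
      by rewrite mulr0 mul0r !subr0 expr0n addr0 mulr_gt0 ?exprn_gt0.
    have : r * t j < (2 * d - 1) * s i * t j by rewrite ltr_pM2r.
    have := mulr_ge0 (ltW d0) (sqr_ge0 (s i - t j)); nra.
  have : 0 < \sum_j \sum_i a j * b i *
     (d * (s i ^+ 2 + t j ^+ 2) - r * t j - t j * s i).
    have [j aj] : exists j, 0 < a j.
      apply/existsP/contraT => /existsPn H; move: Tp.
      by rewrite /T big1 ?ltxx // => j _; apply/eqP; rewrite eq_le a0 leNgt H.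
    have [i bi] : exists i, 0 < b i.
      apply/existsP/contraT => /existsPn H; move: Tp.
      by rewrite Tb big1 ?ltxx // => i _; apply/eqP; rewrite eq_le b0 leNgt H.
    have nn i' j' :
        0 <= a j' * b i' * (d * (s i' ^+ 2 + t j' ^+ 2) - r * t j' - t j' * s i').
      by rewrite mulr_ge0 ?mulr_ge0 // ltW.
    rewrite (bigD1 j) //= ltr_wpDr ?sumr_ge0 // => [j' _|];
      first by apply: sumr_ge0.
    rewrite (bigD1 i) //= ltr_wpDr ?sumr_ge0 //.
    by rewrite !mulr_gt0.
  rewrite ltNge => /negP; apply.
  rewrite -subr_le0 in h3; apply: le_trans h3.
  rewrite -big_split -sumrB ler_sum // => j _ /=.
  rewrite -big_split -sumrB ler_sum // => i _ /=.
  by rewrite le_eqVlt; apply/orP; left; apply/eqP; ring.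
(* When [T = 0] no defect is left, so [n1] and [n2] are at most 0. For [K = 0] no index bounds [n2],
   but [e] is then made of empty sums. *)
have aj0 j : a j = 0.
  move/eqP: T00; rewrite psumr_eq0 // => /allP/(_ j) H; apply/eqP/H.
  by rewrite mem_index_enum.
have bi0 i : b i = 0.
  move/eqP: T00; rewrite Tb psumr_eq0 // => /allP/(_ i) H; apply/eqP/H.
  by rewrite mem_index_enum.
have n10 : n1 <= 0.
  by move: Hn1; rewrite big1 ?mulr0 // => j _; rewrite -/(a j) aj0 mul0r.
case: (posnP K) => [K0|Kp].
  subst K; rewrite /e !big_ord0; lra.
have n20 : n2 <= 0.
  by move: (Hn2 (Ordinal Kp)); rewrite big1 ?mulr0 // => i _;
    rewrite -/(b i) bi0 mul0r.
have : d * e <= 0 by lra.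
by rewrite pmulr_rle0.
Qed.

(** * The real part of the Frobenius inner product *)

Section RealDot.
Local Open Scope sesquilinear_scope.
Variable R : rcfType.
Local Notation C := R[i].
Local Notation Re := complex.Re.

Lemma trmxC_mul p q r (X : 'M[C]_(p, q)) (Y : 'M[C]_(q, r)) :
  (X *m Y)^t* = Y^t* *m X^t*.
Proof. by rewrite trmx_mul map_mxM. Qed.

Lemma trmxCD p q (X Y : 'M[C]_(p, q)) : (X + Y)^t* = X^t* + Y^t*.
Proof. by rewrite linearD map_mxD. Qed.

Lemma trmxCZ p q (a : C) (X : 'M[C]_(p, q)) : (a *: X)^t* = a^* *: X^t*.
Proof. by rewrite linearZ map_mxZ. Qed.

Lemma ReZ (a : R) (z : C) : Re (a%:C%C * z) = a * Re z.
Proof. by case: z => x y /=; rewrite mul0r subr0. Qed.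

Lemma ReD (z w : C) : Re (z + w) = Re z + Re w.
Proof. by case: z w => x y [u v]. Qed.

Lemma ReN (z : C) : Re (- z) = - Re z.
Proof. by case: z => x y. Qed.

Lemma Re_sum I (r : seq I) (P : pred I) (F : I -> C) :
  Re (\sum_(i <- r | P i) F i) = \sum_(i <- r | P i) Re (F i).
Proof. exact: (big_morph _ ReD erefl). Qed.

Lemma Re_conjc (z : C) : Re z^* = Re z.
Proof. by case: z => x y. Qed.

Lemma conj_RC (a : R) : (a%:C%C)^* = a%:C%C :> C.
Proof. exact: conjc_real. Qed.

Definition sqmod (z : C) : R := Re (z * z^*).

Lemma sqmod_ge0 z : 0 <= sqmod z.
Proof. by case: z => x y; rewrite /sqmod /=; nra. Qed.

Lemma sqmod0 : sqmod 0 = 0. Proof. by rewrite /sqmod mul0r. Qed.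

(** The trace form lets a matrix factor cross to the other argument as its adjoint. *)
Definition rdot p q (X Y : 'M[C]_(p, q)) : R := Re (\tr (Y^t* *m X)).

Lemma rdotDl p q (X Y Z : 'M[C]_(p, q)) : rdot (X + Y) Z = rdot X Z + rdot Y Z.
Proof. by rewrite /rdot mulmxDr mxtraceD ReD. Qed.

Lemma rdotNl p q (X Z : 'M[C]_(p, q)) : rdot (- X) Z = - rdot X Z.
Proof. by rewrite /rdot mulmxN linearN ReN. Qed.

Lemma rdotBl p q (X Y Z : 'M[C]_(p, q)) : rdot (X - Y) Z = rdot X Z - rdot Y Z.
Proof. by rewrite rdotDl rdotNl. Qed.

Lemma rdotZl p q a (X Z : 'M[C]_(p, q)) : rdot (a%:C%C *: X) Z = a * rdot X Z.
Proof. by rewrite /rdot -scalemxAr mxtraceZ ReZ. Qed.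

Lemma rdotC p q (X Y : 'M[C]_(p, q)) : rdot X Y = rdot Y X.
Proof.
rewrite /rdot -[in RHS](trmxCK Y) -trmxC_mul -Re_conjc; congr Re.
by rewrite /mxtrace rmorph_sum; apply: eq_bigr => i _; rewrite !mxE.
Qed.

Lemma rdotDr p q (X Y Z : 'M[C]_(p, q)) : rdot Z (X + Y) = rdot Z X + rdot Z Y.
Proof. by rewrite !(rdotC Z) rdotDl. Qed.

Lemma rdotNr p q (X Z : 'M[C]_(p, q)) : rdot Z (- X) = - rdot Z X.
Proof. by rewrite !(rdotC Z) rdotNl. Qed.

Lemma rdotBr p q (X Y Z : 'M[C]_(p, q)) : rdot Z (X - Y) = rdot Z X - rdot Z Y.
Proof. by rewrite rdotDr rdotNr. Qed.

Lemma rdotZr p q a (X Z : 'M[C]_(p, q)) : rdot Z (a%:C%C *: X) = a * rdot Z X.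
Proof. by rewrite !(rdotC Z) rdotZl. Qed.

Lemma rdot0l p q (X : 'M[C]_(p, q)) : rdot 0 X = 0.
Proof. by rewrite /rdot mulmx0 mxtrace0. Qed.

Lemma rdot0r p q (X : 'M[C]_(p, q)) : rdot X 0 = 0.
Proof. by rewrite rdotC rdot0l. Qed.

Lemma rdotMl p q r (A : 'M[C]_(r, p)) (X : 'M[C]_(p, q)) Y :
  rdot (A *m X) Y = rdot X (A^t* *m Y).
Proof. by rewrite /rdot trmxC_mul trmxCK mulmxA. Qed.

Lemma rdotMr p q r (X : 'M[C]_(p, q)) (A : 'M[C]_(q, r)) Y :
  rdot (X *m A) Y = rdot X (Y *m A^t*).
Proof. by rewrite /rdot trmxC_mul trmxCK mulmxA mxtrace_mulC mulmxA. Qed.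

Lemma rdotE p q (X Y : 'M[C]_(p, q)) :
  rdot X Y = \sum_i \sum_j Re (X i j * (Y i j)^*).
Proof.
rewrite /rdot /mxtrace Re_sum.
rewrite exchange_big; apply: eq_bigr => j _ /=.
rewrite !mxE Re_sum.
by apply: eq_bigr => i _; rewrite !mxE mulrC.
Qed.

Lemma rdot_ge0 p q (X : 'M[C]_(p, q)) : 0 <= rdot X X.
Proof.
by rewrite rdotE sumr_ge0 // => i _; rewrite sumr_ge0 // => j _; apply: sqmod_ge0.
Qed.

Lemma rdot_eq0 p q (X : 'M[C]_(p, q)) : (rdot X X == 0) = (X == 0).
Proof.
apply/idP/eqP => [|->]; last by rewrite rdot0l.
rewrite rdotE psumr_eq0; last first.
  by move=> i _; rewrite sumr_ge0 // => j _; apply: sqmod_ge0.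
move=> /allP H; apply/matrixP => i j.
have := H i (mem_index_enum _); rewrite psumr_eq0; last first.
  by move=> ? _; apply: sqmod_ge0.
move=> /allP/(_ j (mem_index_enum _))/=; rewrite mxE.
case: (X i j) => x y /= h; apply/eqP.
have h' : x ^+ 2 + y ^+ 2 == 0 by rewrite -(eqP h); apply/eqP; ring.
by move: h'; rewrite paddr_eq0 ?sqr_ge0 // !sqrf_eq0 eq_complex.
Qed.

Lemma rdot_gt0 p q (X : 'M[C]_(p, q)) : X != 0 -> 0 < rdot X X.
Proof. by move=> X0; rewrite lt_neqAle rdot_ge0 eq_sym rdot_eq0 X0. Qed.

Lemma trmxC_mul_col p (v : 'cV[C]_p) : v^t* *m v = (rdot v v)%:C%C%:M.
Proof.
rewrite [LHS]mx11_scalar; congr (_%:M).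
rewrite /rdot /mxtrace big_ord1; apply/esym/RRe_real.
rewrite mxE; apply: rpred_sum => i _; rewrite !mxE mulrC.
by apply: ger0_real; rewrite mul_conjC_ge0.
Qed.

End RealDot.

(** * Real matrices among the complex ones *)

Section RealEntries.
Local Open Scope sesquilinear_scope.
Variable R : rcfType.
Local Notation C := R[i].
Local Notation Re := complex.Re.
Local Notation Im := complex.Im.

(* Real matrices are handled inside the complex ones: [b] tells whether the
   scalar field is R. *)
Definition over (b : bool) p q (X : 'M[C]_(p, q)) : Prop :=
  b -> map_mx Num.conj X = X.

Variable b : bool.

Lemma overD p q (X Y : 'M[C]_(p, q)) : over b X -> over b Y -> over b (X + Y).
Proof. by move=> hX hY hb; rewrite map_mxD hX // hY. Qed.

Lemma overN p q (X : 'M[C]_(p, q)) : over b X -> over b (- X).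
Proof. by move=> hX hb; rewrite map_mxN hX. Qed.

Lemma overB p q (X Y : 'M[C]_(p, q)) : over b X -> over b Y -> over b (X - Y).
Proof. by move=> hX hY; apply/overD/overN. Qed.

Lemma overM p q r (X : 'M[C]_(p, q)) (Y : 'M[C]_(q, r)) :
  over b X -> over b Y -> over b (X *m Y).
Proof. by move=> hX hY hb; rewrite map_mxM hX // hY. Qed.

Lemma overZ p q a (X : 'M[C]_(p, q)) : over b X -> over b (a%:C%C *: X).
Proof. by move=> hX hb; rewrite map_mxZ hX //= conj_RC. Qed.

Lemma over_trmxC p q (X : 'M[C]_(p, q)) : over b X -> over b (X^t*).
Proof. by move=> hX hb; rewrite -{2}hX // map_trmx. Qed.

Definition Re_mx p q (X : 'M[C]_(p, q)) : 'M[C]_(p, q) :=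
  map_mx (fun z => (Re z)%:C%C) X.
Definition Im_mx p q (X : 'M[C]_(p, q)) : 'M[C]_(p, q) :=
  map_mx (fun z => (Im z)%:C%C) X.

Lemma over_Re_mx p q (X : 'M[C]_(p, q)) : over b (Re_mx X).
Proof. by move=> _; apply/matrixP => i j; rewrite !mxE conj_RC. Qed.

Lemma over_Im_mx p q (X : 'M[C]_(p, q)) : over b (Im_mx X).
Proof. by move=> _; apply/matrixP => i j; rewrite !mxE conj_RC. Qed.

Lemma over_entry p q (X : 'M[C]_(p, q)) i j :
  map_mx Num.conj X = X -> X i j = (Re (X i j))%:C%C.
Proof.
move/matrixP/(_ i j); rewrite mxE; case: (X i j) => x y [] /esym/eqP.
by rewrite eq_sym -subr_eq0 -opprD oppr_eq0 -mulr2n mulrn_eq0 => /eqP->.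
Qed.

Lemma Re_mx_mul p q r (X : 'M[C]_(p, q)) (Y : 'M[C]_(q, r)) :
  map_mx Num.conj X = X -> Re_mx (X *m Y) = X *m Re_mx Y.
Proof.
move=> hX; apply/matrixP => i j; rewrite !mxE Re_sum rmorph_sum.
apply: eq_bigr => l _ /=; rewrite [X i l](over_entry _ _ hX) ReZ rmorphM.
by rewrite mxE.
Qed.

Lemma Im_mx_mul p q r (X : 'M[C]_(p, q)) (Y : 'M[C]_(q, r)) :
  map_mx Num.conj X = X -> Im_mx (X *m Y) = X *m Im_mx Y.
Proof.
move=> hX; apply/matrixP => i j; rewrite !mxE.
have -> : Im (\sum_j0 X i j0 * Y j0 j) = \sum_j0 Im (X i j0 * Y j0 j).
  by apply: (big_morph _ _ erefl) => -[? ?] [? ?].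
rewrite rmorph_sum; apply: eq_bigr => l _ /=.
rewrite [X i l](over_entry _ _ hX) mxE -rmorphM; congr (_%:C)%C.
by case: (Y l j) => x y /=; rewrite mul0r addr0.
Qed.

Lemma rdot_Re_Im_mx p q (X : 'M[C]_(p, q)) :
  rdot X X = rdot (Re_mx X) (Re_mx X) + rdot (Im_mx X) (Im_mx X).
Proof.
rewrite !rdotE -big_split; apply: eq_bigr => i _.
rewrite -big_split; apply: eq_bigr => j _; rewrite !mxE.
by case: (X i j) => x y /=; ring.
Qed.

Lemma Re_Im_mx_eq0 p q (X : 'M[C]_(p, q)) : Re_mx X = 0 -> Im_mx X = 0 -> X = 0.
Proof.
by move=> X1 X2; apply/eqP; rewrite -rdot_eq0 rdot_Re_Im_mx X1 X2 !rdot0l addr0.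
Qed.

(** A real [N] commutes with taking real and imaginary parts, and the squared norms of the two parts
    add up. Competitors built from real vectors thus give bounds valid for all complex vectors. *)
Lemma over_bound p q (N : 'M[C]_(p, q)) (c : R) :
  over b N ->
  (forall y : 'cV[C]_q, over b y -> rdot (N *m y) (N *m y) <= c * rdot y y) ->
  forall y : 'cV[C]_q, rdot (N *m y) (N *m y) <= c * rdot y y.
Proof.
move=> hN H y; case bE : b; last by apply: H; rewrite bE.
rewrite rdot_Re_Im_mx Re_mx_mul ?Im_mx_mul ?hN //.
rewrite [rdot y y]rdot_Re_Im_mx mulrDr lerD // H //;
  [exact: over_Re_mx | exact: over_Im_mx].
Qed.

(** If [G] is real, the real and imaginary parts of [v] satisfy the same eigenvector equation, as
    [c] is real, and one of them is nonzero. *)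
Lemma over_eigenvector q (G : 'M[C]_q) (v : 'cV[C]_q) (c : R) :
  over b G -> v != 0 -> G *m v = c%:C%C *: v ->
  exists w : 'cV[C]_q, [/\ over b w, w != 0 & G *m w = c%:C%C *: w].
Proof.
move=> hG v0 Gv; case bE : b; last by exists v.
have hGv := hG bE.
have [p0|p0] := eqVneq (Re_mx v) 0; last first.
  exists (Re_mx v); split => //; first by rewrite -bE; apply: over_Re_mx.
  rewrite -Re_mx_mul // Gv; apply/matrixP => i j; rewrite !mxE.
  by rewrite ReZ rmorphM.
exists (Im_mx v); split => //; first by rewrite -bE; apply: over_Im_mx.
  by apply: contraNneq v0 => q0; apply/eqP/Re_Im_mx_eq0.
rewrite -Im_mx_mul // Gv; apply/matrixP => i j; rewrite !mxE -rmorphM.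
by congr (_%:C)%C; case: (v i j) => x y /=; rewrite mul0r addr0.
Qed.

End RealEntries.

(** * Optimality conditions for best rank-K approximation *)

Section BestApprox.
Local Open Scope sesquilinear_scope.
Variable R : rcfType.
Local Notation C := R[i].

Lemma quadratic_slope0 (a c : R) : 0 <= a -> 0 <= c ->
  (forall t, 2 * (t * a) <= t ^+ 2 * c) -> a = 0.
Proof.
(* With [u = a / (c + 1)] the inequality reads [2 * u ^+ 2 * (c + 1) <= u ^+ 2 * c], so [u = 0]; the
   [+ 1] keeps the denominator positive. *)
move=> a0 c0 /(_ (a / (c + 1))) H.
have c1 : 0 < c + 1 by rewrite ltr_wpDl.
have E : a / (c + 1) * (c + 1) = a by rewrite divfK // gt_eqF.
set u := a / (c + 1) in H E; rewrite -E in a0 H *.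
have : u ^+ 2 <= 0 by nra.
by rewrite exprn_even_le0 //= => /eqP->; rewrite mul0r.
Qed.

Variables (b : bool) (n1 n2 K : nat) (X N : 'M[C]_(n1, n2)).
Hypotheses (oX : over b X) (oN : over b N) (rX : (\rank X <= K)%N).
(** This is [|N|^2 <= |W - (X + N)|^2] with the square expanded: [X] is a best approximation of
    [X + N]. *)
Hypothesis best : forall W : 'M[C]_(n1, n2), over b W -> (\rank W <= K)%N ->
  2 * rdot (W - X) N <= rdot (W - X) (W - X).

(** Along the line [X + t M], [best] becomes [2 t <M, N> <= t^2 |M|^2] for every real [t]. *)
Lemma best_critical (M : 'M[C]_(n1, n2)) : over b M ->
  (forall t : R, (\rank (X + t%:C%C *: M)%R <= K)%N) -> 0 <= rdot M N -> rdot M N = 0.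
Proof.
move=> oM rM MN; apply: (quadratic_slope0 MN (rdot_ge0 M)) => t.
have := best (overD oX (overZ t oM)) (rM t).
by rewrite (addrC X) addrK rdotZl rdotZl rdotZr mulrA -expr2.
Qed.

(** The direction is [M = X *m (X^t* *m N)]: it stays in the column space of [X], and [<M, N>] is
    the squared norm of [X^t* *m N]. *)
Lemma best_left_orthogonal : X^t* *m N = 0.
Proof.
apply/eqP; rewrite -rdot_eq0 rdotMl trmxCK rdotC; apply/eqP/best_critical.
- by apply/overM/overM => //; apply: over_trmxC.
- move=> t; rewrite scalemxAr -[X in (X + _)%R]mulmx1 -mulmxDr.
  exact: leq_trans (mxrankM_maxl _ _) rX.
- by rewrite rdotMl rdot_ge0.
Qed.

Lemma best_right_orthogonal : N *m X^t* = 0.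
Proof.
apply/eqP; rewrite -rdot_eq0 rdotMr trmxCK rdotC; apply/eqP/best_critical.
- by apply/overM => //; apply/overM => //; apply: over_trmxC.
- move=> t; rewrite scalemxAl -[X in (X + _)%R]mul1mx -mulmxDl.
  exact: leq_trans (mxrankM_maxr _ _) rX.
- by rewrite rdotMr rdot_ge0.
Qed.

Lemma best_left_orthogonalC : N^t* *m X = 0.
Proof. by rewrite -(trmxCK X) -trmxC_mul best_left_orthogonal trmx0 map_mx0. Qed.

Lemma rank_outer p q (x : 'cV[C]_p) (y : 'cV[C]_q) : (\rank (x *m y^t*) <= 1)%N.
Proof. exact: leq_trans (mxrankM_maxl _ _) (rank_leq_col _). Qed.

(** The spare unit of rank allows the direction [N y y^*] for any [y], whose product with [N] is
    [|N y|^2]. *)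
Lemma best_deficient : (\rank X < K)%N -> N = 0.
Proof.
move=> rXK; suff H : forall y : 'cV[C]_n2, rdot (N *m y) (N *m y) <= 0 * rdot y y.
  apply/matrixP => i j; have := H (delta_mx j 0); rewrite mul0r => h.
  have : rdot (N *m delta_mx j (0 : 'I_1)) (N *m delta_mx j 0) == 0.
    by rewrite eq_le h rdot_ge0.
  by rewrite rdot_eq0 -colE => /eqP/matrixP/(_ i 0); rewrite !mxE.
apply: (over_bound oN) => y oy; rewrite mul0r.
have : rdot (N *m y *m y^t*) N = 0.
  apply: best_critical.
  - by apply/overM/over_trmxC => //; apply: overM.
  - move=> t; apply: leq_trans (mxrank_add _ _) _.
    rewrite scalemxAl; apply: leq_trans (leq_add (leqnn _) (rank_outer _ _)) _.
    by rewrite addn1.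
  - by rewrite rdotMr trmxCK rdot_ge0.
by rewrite rdotMr trmxCK => ->.
Qed.

(* The competitor is [X - X v v^* / |v|^2 + |y|^-2 (N y) y^*]: removing the
   singular direction [v] frees one unit of rank. *)
Lemma best_opnorm (s : R) (v : 'cV[C]_n2) : 0 < s -> v != 0 ->
  X^t* *m X *m v = (s ^+ 2)%:C%C *: v ->
  forall y : 'cV[C]_n2, rdot (N *m y) (N *m y) <= s ^+ 2 * rdot y y.
Proof.
move=> s0 v0 Xv.
have {v v0 Xv}[v [ov v0 Xv]] : exists w : 'cV[C]_n2,
    [/\ over b w, w != 0 & X^t* *m X *m w = (s ^+ 2)%:C%C *: w].
  by apply: over_eigenvector v0 Xv; apply/overM => //; apply: over_trmxC.
apply: (over_bound oN) => y oy.
have [->|y0] := eqVneq y 0; first by rewrite mulmx0 rdot0l rdot0l mulr0.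
have vp := rdot_gt0 v0; have yp := rdot_gt0 y0.
have Xvp : rdot (X *m v) (X *m v) = s ^+ 2 * rdot v v.
  by rewrite rdotMl mulmxA Xv rdotZr.
pose a := (rdot v v)^-1; pose c := (rdot y y)^-1.
pose P := X *m v *m v^t*.
pose X1 := X - a%:C%C *: P.
have vvP := trmxC_mul_col v.
have X1v : X1 *m v = 0.
  rewrite /X1 mulmxBl -scalemxAl /P -[X *m v *m _ *m _]mulmxA vvP mul_mx_scalar.
  by rewrite scalerA -rmorphM mulVf ?gt_eqF // scale1r subrr.
(* As [v] is an eigenvector of [X^t* *m X], [X v v^*] is itself a left multiple of [X]. *)
have X1X : (X1 <= X)%MS.
  apply/submxP; exists (1%:M - (a / s ^+ 2)%:C%C *: (X *m v *m v^t* *m X^t*)).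
  rewrite mulmxBl mul1mx /X1 -scalemxAl; congr (_ - _).
  have -> : X *m v *m v^t* *m X^t* *m X = (s ^+ 2)%:C%C *: P.
    rewrite -!mulmxA.
    have -> : v^t* *m (X^t* *m X) = (s ^+ 2)%:C%C *: v^t*.
      have -> : v^t* *m (X^t* *m X) = (X^t* *m X *m v)^t*.
        by rewrite !trmxC_mul trmxCK.
      by rewrite Xv trmxCZ conj_RC.
    by rewrite -!scalemxAr /P mulmxA.
  by rewrite scalerA -rmorphM divfK // expf_eq0 /= gt_eqF.
(* Equal ranks would make [X] a left multiple of [X1], so [X v = 0], against
   [|X v|^2 = s^2 |v|^2 > 0]. *)
have rX1 : (\rank X1 < \rank X)%N.
  rewrite ltn_neqAle mxrankS // andbT; apply/negP => /eqP rE.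
  have [_ /esym] := mxrank_leqif_sup X1X; rewrite rE eqxx => /submxP[D XD].
  have : rdot (X *m v) (X *m v) = 0 by rewrite XD -mulmxA X1v mulmx0 rdot0l.
  by move/eqP; rewrite Xvp mulf_eq0 expf_eq0 /= !gt_eqF.
pose Q := N *m y *m y^t*.
have oP : over b P by apply/overM/over_trmxC => //; apply: overM.
have oQ : over b Q by apply/overM/over_trmxC => //; apply: overM.
have oW : over b (X1 + c%:C%C *: Q).
  by apply/overD/overZ => //; apply/overB/overZ.
have rW : (\rank (X1 + c%:C%C *: Q)%R <= K)%N.
  apply: leq_trans (mxrank_add _ _) _.
  rewrite scalemxAl; apply: leq_trans (leq_add (leqnn _) (rank_outer _ _)) _.
  by rewrite addn1; apply: leq_trans rX1 rX.
(* Since [P] is orthogonal to [N] and to [Q], this is [2 m / |y|^2 <= m / |y|^2 + s^2] with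
   [m = |N y|^2]. *)
have := best oW rW.
have -> : X1 + c%:C%C *: Q - X = c%:C%C *: Q - a%:C%C *: P.
  by rewrite /X1 [X in X - _]addrC -addrA [X in _ + X]addrAC subrr sub0r.
have PN : rdot P N = 0.
  by rewrite /P -mulmxA rdotMl best_left_orthogonal rdot0r.
have PP : rdot P P = s ^+ 2 * (rdot v v) ^+ 2.
  by rewrite /P rdotMr trmxCK -mulmxA vvP mul_mx_scalar rdotZr Xvp; ring.
have QN : rdot Q N = rdot (N *m y) (N *m y) by rewrite /Q rdotMr trmxCK.
have yyP := trmxC_mul_col y.
have QQ : rdot Q Q = rdot (N *m y) (N *m y) * rdot y y.
  by rewrite /Q rdotMr trmxCK -mulmxA yyP mul_mx_scalar rdotZr; ring.
have QP : rdot Q P = 0.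
  by rewrite /Q /P -!mulmxA rdotMl [N^t* *m _]mulmxA best_left_orthogonalC mul0mx rdot0r.
rewrite !(rdotBl, rdotBr, rdotZl, rdotZr) PN [rdot P Q]rdotC QP PP QN QQ /a /c.
set m := rdot (N *m y) _; set yy := rdot y y; set vv := rdot v v => h.
have {h} : m / yy <= s ^+ 2.
  have E1 : yy^-1 * yy = 1 by rewrite mulVf ?gt_eqF.
  have E2 : vv^-1 * vv = 1 by rewrite mulVf ?gt_eqF.
  move: h; rewrite !(mulr0, subr0, sub0r, oppr0, opprK).
  have -> : vv^-1 * (vv^-1 * (s ^+ 2 * vv ^+ 2)) = s ^+ 2.
    by field; rewrite gt_eqF.
  have -> : yy^-1 * (yy^-1 * (m * yy)) = m / yy.
    by field; rewrite gt_eqF.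
  lra.
by rewrite ler_pdivrMr.
Qed.

End BestApprox.

(** * Compact singular value decomposition *)

(** List [S] first, then its complement, and keep the first [K] entries. *)
Lemma injective_cover n K (S : {set 'I_n}) : (#|S| <= K <= n)%N ->
  exists f : 'I_K -> 'I_n, injective f /\ forall j, j \in S -> exists k, j = f k.
Proof.
case/andP=> SK Kn; pose l := enum S ++ enum (~: S).
have sl : size l == n by rewrite size_cat -!cardE cardsC card_ord.
have ul : uniq l.
  rewrite cat_uniq !enum_uniq /= andbT; apply/hasPn => j.
  by rewrite !mem_enum finset.in_setC.
exists (fun k => tnth (Tuple sl) (widen_ord Kn k)); split.
  by move=> k k' /(tuple_uniqP (Tuple sl) ul)/(congr1 val)/= /val_inj.
move=> j jS; have jK : (index j (enum S) < K)%N.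
  by apply: leq_trans SK; rewrite cardE index_mem mem_enum.
exists (Ordinal jK); rewrite (tnth_nth j) /= nth_cat index_mem mem_enum jS.
by rewrite nth_index // mem_enum.
Qed.

Section SVD.
Local Open Scope sesquilinear_scope.
Variable R : rcfType.
Local Notation C := R[i].
Local Notation Re := complex.Re.

Definition rdiag K (s : 'I_K -> R) : 'M[C]_K := diag_mx (\row_j (s j)%:C%C).

Lemma rdot_col n (c : 'cV[C]_n) : rdot c c = \sum_k sqmod (c k 0).
Proof. by rewrite rdotE; apply: eq_bigr => k _; rewrite big_ord1. Qed.

Lemma rdot_rdiag n (a : 'I_n -> R) (c : 'cV[C]_n) :
  rdot (rdiag a *m c) c = \sum_k a k * sqmod (c k 0).
Proof.
rewrite rdotE; apply: eq_bigr => k _; rewrite big_ord1 mul_diag_mx !mxE.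
by rewrite -mulrA ReZ.
Qed.

Lemma rdiagM n (a c : 'I_n -> R) :
  rdiag a *m rdiag c = rdiag (fun k => a k * c k).
Proof.
by rewrite mulmx_diag; congr diag_mx; apply/rowP => k; rewrite !mxE rmorphM.
Qed.

Lemma eq_rdiag n (a c : 'I_n -> R) : a =1 c -> rdiag a = rdiag c.
Proof. by move=> ac; apply/matrixP => k l; rewrite !mxE ac. Qed.

Lemma trmxC_rdiag n (a : 'I_n -> R) : (rdiag a)^t* = rdiag a.
Proof.
apply/matrixP => k l; rewrite !mxE eq_sym.
by case: eqP => [->|_]; rewrite ?mulr1n ?mulr0n ?rmorph0 // conj_RC.
Qed.

(** The principal submatrix on the support is an invertible diagonal matrix, and passing to it
    cannot raise the rank. *)
Lemma card_support_diag n (d : 'rV[C]_n) :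
  (#|[set j | d 0%R j != 0%R]| <= \rank (diag_mx d))%N.
Proof.
set S := [set j | _]; pose g (k : 'I_#|S|) : 'I_n := enum_val k.
have -> : #|S| = \rank (mxsub g g (diag_mx d)).
  have -> : mxsub g g (diag_mx d) = diag_mx (\row_k d 0 (g k)).
    apply/matrixP => k l; rewrite !mxE; congr (_ *+ _).
    by rewrite (inj_eq enum_val_inj).
  rewrite mxrank_unit // unitmxE det_diag unitfE; apply/prodf_neq0 => k _.
  by rewrite mxE; have := enum_valP k; rewrite inE.
have -> : mxsub g g (diag_mx d) = rowsub g (diag_mx d) *m colsub g 1%:M.
  by rewrite -mxsub_mul mulmx1.
exact: leq_trans (mxrankM_maxl _ _) (mxrankS (rowsub_sub _ _)).
Qed.

(** The columns of [X V], for [V] an orthonormal eigenbasis of the Gram matrix, are orthogonal and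
    their squared norms are the eigenvalues, which are therefore real and nonnegative. *)
Lemma gram_spectral n1 n2 (X : 'M[C]_(n1, n2)) :
  let d := spectral_diag (X^t* *m X) in
  exists V, [/\ V^t* *m V = 1%:M, V *m V^t* = 1%:M,
      (X *m V)^t* *m (X *m V) = diag_mx d &
      forall j, d 0 j = (rdot (col j (X *m V)) (col j (X *m V)))%:C%C].
Proof.
move=> d; pose V := (spectralmx (X^t* *m X))^t*; exists V.
have uP := spectral_unitarymx (X^t* *m X).
have V1 : V^t* *m V = 1%:M by rewrite trmxCK; apply/unitarymxP.
have V2 : V *m V^t* = 1%:M by apply: mulmx1C.
have GE : X^t* *m X = V *m diag_mx d *m V^t*.
  have /orthomx_spectralP {1}-> : X^t* *m X \is normalmx.
    by apply/normalmxP; rewrite trmxC_mul trmxCK.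
  by rewrite invmx_unitary // trmxCK.
have BE : (X *m V)^t* *m (X *m V) = diag_mx d.
  rewrite trmxC_mul -!mulmxA [X^t* *m _]mulmxA GE -!mulmxA V1 mulmx1 mulmxA V1.
  by rewrite mul1mx.
split=> // j; have /matrixP/(_ j j) := BE.
rewrite [RHS]mxE eqxx mulr1n => <-.
have /matrixP/(_ 0 0) := trmxC_mul_col (col j (X *m V)).
rewrite [in RHS]mxE eqxx mulr1n => <-; rewrite !mxE.
by apply: eq_bigr => i _; rewrite !mxE.
Qed.

(* The columns of [U] with [s j = 0] are zero. *)
Lemma compact_svd n1 n2 K (X : 'M[C]_(n1, n2)) : (\rank X <= K <= n2)%N ->
  exists (U : 'M[C]_(n1, K)) (V : 'M[C]_(n2, K)) (s : 'I_K -> R),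
  [/\ V^t* *m V = 1%:M, U^t* *m U = rdiag (fun j => (s j != 0)%:R),
      X = U *m rdiag s *m V^t* & forall j, 0 <= s j].
Proof.
case/andP=> rX Kn; have [V0 [V1 V2 BE dE]] := gram_spectral X;
set d := spectral_diag _ in BE dE.
have [f [finj fS]] : exists f : 'I_K -> 'I_n2, injective f /\
    forall j, j \in [set j | d 0 j != 0] -> exists k, j = f k.
  apply: injective_cover; rewrite Kn andbT; apply: leq_trans rX.
  apply: leq_trans (card_support_diag d) _; rewrite -BE.
  by apply: leq_trans (mxrankM_maxr _ _) (mxrankM_maxl _ _).
pose s k := Num.sqrt (rdot (col (f k) (X *m V0)) (col (f k) (X *m V0))).
have sE k : s k ^+ 2 = rdot (col (f k) (X *m V0)) (col (f k) (X *m V0)).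
  by rewrite sqr_sqrtr // rdot_ge0.
pose V := colsub f V0.
have VV : V^t* *m V = 1%:M.
  have -> : V^t* *m V = mxsub f f (V0^t* *m V0).
    by apply/matrixP => k l; rewrite !mxE; apply: eq_bigr => i _; rewrite !mxE.
  by rewrite V1; apply/matrixP => k l; rewrite !mxE (inj_eq finj).
(* The inverse of 0 is 0, which yields the zero columns of [U]. *)
pose U := X *m V *m rdiag (fun k => (s k)^-1).
have XVXV : (X *m V)^t* *m (X *m V) = rdiag (fun k => s k ^+ 2).
  have -> : (X *m V)^t* *m (X *m V) = mxsub f f ((X *m V0)^t* *m (X *m V0)).
    have -> : X *m V = colsub f (X *m V0) by rewrite mulmx_colsub.
    by apply/matrixP => k l; rewrite !mxE; apply: eq_bigr => i _; rewrite !mxE.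
  rewrite BE; apply/matrixP => k l.
  by rewrite !mxE (inj_eq finj) dE sE.
exists U, V, s; split => //; last by move=> k; apply: sqrtr_ge0.
  rewrite /U; set Y := X *m V in XVXV *.
  rewrite trmxC_mul trmxC_rdiag -mulmxA [Y^t* *m _]mulmxA XVXV !rdiagM.
  apply/matrixP => k l; rewrite !mxE; congr (_%:C%C *+ _).
  have [sk|sk] := eqVneq (s k) 0; first by rewrite sk invr0 mul0r.
  by rewrite /=; field.
(* The columns of [X *m V0] not selected by [f] have eigenvalue 0, hence vanish. *)
have XE : X = X *m V *m V^t*.
  rewrite -{1}[X]mulmx1 -V2 mulmxA; apply/matrixP => i l.
  rewrite mulmx_colsub !mxE.
  rewrite (bigID (mem [set f k | k in finset.setT])) /= [X in _ + X]big1 ?addr0;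
    last first.
    move=> j jf; suff -> : (X *m V0) i j = 0 by rewrite mul0r.
    have : d 0 j == 0.
      apply/contraT => dj; have [|k jk] := fS j; first by rewrite inE.
      by case/finset.imsetP: jf; exists k.
    rewrite dE -(rmorph0 (real_complex R)) (inj_eq (@complexI R)) rdot_eq0.
    by move=> /eqP/matrixP/(_ i 0); rewrite !mxE.
  rewrite big_imset /=; last by move=> ? ? _ _; apply: finj.
  by apply: eq_big => [k|k _]; rewrite ?inE // !mxE.
rewrite {1}XE /U -[_ *m rdiag _ *m rdiag _]mulmxA rdiagM; congr (_ *m _).
apply/matrixP => i k; rewrite mul_mx_diag [RHS]mxE mxE [(\row__ _) _ _]mxE.
have [sk|sk] := eqVneq (s k) 0; last by rewrite mulVf // mulr1.
have : s k ^+ 2 == 0 by rewrite sk expr0n.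
rewrite sE rdot_eq0 => /eqP/matrixP/(_ i 0) E.
rewrite sk mulr0 mulr0; move: E; rewrite !mxE => E; rewrite -[RHS]E.
by apply: eq_bigr => l _; rewrite mxE.
Qed.

End SVD.

(** * Singular structure of a best approximation and its residual *)

Section Residual.
Local Open Scope sesquilinear_scope.
Variable R : rcfType.
Local Notation C := R[i].
Local Notation Re := complex.Re.

Lemma rdot_proj n K (V : 'M[C]_(n, K)) (y : 'cV[C]_n) : V^t* *m V = 1%:M ->
  rdot (y - V *m (V^t* *m y)) (y - V *m (V^t* *m y)) =
  rdot y y - rdot (V^t* *m y) (V^t* *m y).
Proof.
move=> VV; set c := V^t* *m y.
rewrite rdotBr !rdotBl [rdot y (V *m c)]rdotC !rdotMl -/c [_^t* *m (_ *m c)]mulmxA VV.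
rewrite mul1mx; ring.
Qed.

(* [N] is the residual [Z - X] of a best rank-K approximation [X] of [Z]. *)
Definition svd_residual n1 n2 K (X N : 'M[C]_(n1, n2)) (U : 'M[C]_(n1, K))
    (V : 'M[C]_(n2, K)) (s : 'I_K -> R) :=
  [/\ V^t* *m V = 1%:M, U^t* *m U = rdiag (fun j => (s j != 0)%:R),
      X = U *m rdiag s *m V^t*, forall j, 0 <= s j &
      [/\ U^t* *m N = 0, N *m V = 0 &
          forall j (y : 'cV[C]_n2), rdot (N *m y) (N *m y) <= s j ^+ 2 * rdot y y]].

Lemma best_svd (b : bool) n1 n2 K (X N : 'M[C]_(n1, n2)) :
  over b X -> over b N -> (\rank X <= K <= n2)%N ->
  (forall W : 'M[C]_(n1, n2), over b W -> (\rank W <= K)%N ->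
    2 * rdot (W - X) N <= rdot (W - X) (W - X)) ->
  exists U V s, @svd_residual n1 n2 K X N U V s.
Proof.
move=> oX oN rX best; have [U [V [s [VV UU XE s0]]]] := compact_svd rX.
have {rX} rX : (\rank X <= K)%N by case/andP: rX.
exists U, V, s; split => //.
(* Below rank [K] the residual is zero and every clause is trivial; at rank [K] all [s j] are
   nonzero and can be cancelled. *)
move: (rX); rewrite leq_eqVlt => /orP[/eqP rXE|rXK]; last first.
  rewrite (best_deficient oX oN best) // mulmx0 mul0mx; split => // j y.
  by rewrite mul0mx rdot0l mulr_ge0 ?sqr_ge0 ?rdot_ge0.
have sN0 j : s j != 0.
  have : rdiag s \in unitmx.
    rewrite -row_full_unit /row_full eqn_leq rank_leq_row -{1}rXE XE.
    by apply: leq_trans (mxrankM_maxl _ _) (mxrankM_maxr _ _).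
  rewrite unitmxE det_diag unitfE => /prodf_neq0/(_ j isT).
  by rewrite mxE -(rmorph0 (real_complex R)) (inj_eq (@complexI R)).
have XV : X *m V = U *m rdiag s by rewrite XE -mulmxA VV mulmx1.
split.
- have : N^t* *m (U *m rdiag s) = 0.
    by rewrite -XV mulmxA (best_left_orthogonalC oX oN rX best) mul0mx.
  rewrite mulmxA mul_mx_diag => /matrixP H.
  rewrite -[LHS]trmxCK trmxC_mul trmxCK; apply/matrixP => i j.
  have := H j i; rewrite !mxE => /eqP; rewrite mulf_eq0 => /orP[/eqP->|].
    by rewrite rmorph0.
  by rewrite -(rmorph0 (real_complex R)) (inj_eq (@complexI R)) (negPf (sN0 i)).
- have : N *m X^t* *m U = 0 by rewrite (best_right_orthogonal oX oN rX best) mul0mx.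
  rewrite XE !trmxC_mul trmxCK trmxC_rdiag -!mulmxA UU rdiagM mulmxA mul_mx_diag.
  move=> /matrixP H; apply/matrixP => i j; have := H i j.
  rewrite [LHS]mxE [RHS]mxE => /eqP; rewrite mulf_eq0 => /orP[/eqP->|];
    first by rewrite !mxE.
  rewrite !mxE -(rmorph0 (real_complex R)) (inj_eq (@complexI R)) sN0 mulr1.
  by rewrite (negPf (sN0 j)).
move=> j y; have sj : 0 < s j by rewrite lt_neqAle eq_sym sN0 s0.
(* The [j]-th column of [V] is the eigenvector of [X^t* *m X] with eigenvalue [s j ^+ 2]. *)
apply: (best_opnorm oX oN rX best (v := col j V) sj).
  apply/eqP => /(congr1 (fun v => v^t* *m v)).
  have -> : (col j V)^t* *m col j V = 1%:M.
    rewrite colE trmxC_mul -mulmxA [V^t* *m _]mulmxA VV mul1mx.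
    apply/matrixP => p q; rewrite !ord1 mxE (bigD1 j) //= big1 ?addr0.
      by rewrite !mxE !eqxx /= rmorph1 mulr1.
    by move=> l /negPf lj; rewrite !mxE lj !mulr0.
  by rewrite mulmx0 => /matrixP/(_ 0 0)/eqP; rewrite !mxE oner_eq0.
have : X^t* *m X *m V = V *m rdiag (fun j => s j ^+ 2).
  rewrite -mulmxA XV XE !trmxC_mul trmxCK trmxC_rdiag -!mulmxA [U^t* *m _]mulmxA UU.
  rewrite !rdiagM; congr (_ *m _); apply: eq_rdiag => k.
  by rewrite sN0 mul1r expr2.
rewrite colE mulmxA => ->; rewrite -mulmxA mul_diag_mx.
rewrite scalemxAr; congr (_ *m _); apply/matrixP => k l; rewrite !mxE.
by case: eqP => [->|] //=; rewrite !mulr0.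
Qed.

Section Compare.
Variables (n1 n2 K : nat) (X N : 'M[C]_(n1, n2)) (U : 'M[C]_(n1, K)).
Variables (V : 'M[C]_(n2, K)) (s : 'I_K -> R).
Hypothesis H : svd_residual X N U V s.

Lemma residual_orthogonal : X^t* *m N = 0.
Proof.
by case: H => _ _ -> _ [UN _ _]; rewrite !trmxC_mul -!mulmxA UN !mulmx0.
Qed.

Lemma residual_gram : X^t* *m X = V *m rdiag (fun j => s j ^+ 2) *m V^t*.
Proof.
case: H => VV UU -> _ _; rewrite !trmxC_mul trmxCK trmxC_rdiag -!mulmxA.
congr (_ *m _); rewrite [U^t* *m _]mulmxA UU !mulmxA !rdiagM.
congr (_ *m _); apply: eq_rdiag => j; have [->|] := eqVneq (s j) 0.
  by rewrite mulr0 expr0n.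
by rewrite mulr1 expr2.
Qed.

(** Pythagoras: [X y] and [N y] are orthogonal. *)
Lemma residual_sqr (y : 'cV[C]_n2) :
  rdot ((X + N) *m y) ((X + N) *m y) =
  \sum_j s j ^+ 2 * sqmod ((V^t* *m y) j 0) + rdot (N *m y) (N *m y).
Proof.
rewrite mulmxDl rdotDl !rdotDr.
have E : rdot (X *m y) (N *m y) = 0.
  by rewrite rdotMl mulmxA residual_orthogonal mul0mx rdot0r.
rewrite [rdot (N *m y) (X *m y)]rdotC E addr0 add0r; congr (_ + _).
by rewrite rdotMl mulmxA residual_gram rdotC -!mulmxA rdotMl rdot_rdiag.
Qed.

End Compare.

End Residual.

(** * Singular values of the sum of an approximation and its residual *)

Lemma sorted_count_lt (R : realDomainType) (l : seq R) k :
  sorted >=%R l -> (k < size l)%N ->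
  (count (fun x => (x < nth 0 l k)%R) l <= size l - k.+1)%N.
Proof.
move=> sl kl; rewrite -{2}(cat_take_drop k.+1 l) count_cat.
suff -> : count (fun x => (x < nth 0 l k)%R) (take k.+1 l) = 0%N.
  by rewrite add0n -size_drop count_size.
apply/eqP; rewrite -leqn0 leqNgt -has_count; apply/hasPn => x.
move=> xl; have [i + <-] := nthP 0 xl;
  rewrite size_take_min leq_min => /andP[ik il].
rewrite nth_take // -leNgt.
have ge_tr : transitive (>=%R : rel R) by move=> a b c /[swap]; apply: le_trans.
have ge_rf : reflexive (>=%R : rel R) by move=> a; apply: lexx.
by apply: (sorted_leq_nth ge_tr ge_rf 0 sl); rewrite ?inE.
Qed.

Lemma sorted_count_gt (R : realDomainType) (l : seq R) k :
  sorted >=%R l -> (k <= size l)%N ->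
  (count (fun x => (nth 0 l k < x)%R) l <= k)%N.
Proof.
move=> sl kl; rewrite -{2}(cat_take_drop k l) count_cat.
suff -> : count (fun x => (nth 0 l k < x)%R) (drop k l) = 0%N.
  by rewrite addn0 (leq_trans (count_size _ _)) // size_take_min geq_minl.
apply/eqP; rewrite -leqn0 leqNgt -has_count; apply/hasPn => x.
move=> xl; have [i + <-] := nthP 0 xl; rewrite size_drop => il.
rewrite nth_drop -leNgt.
have ge_tr : transitive (>=%R : rel R) by move=> a b c /[swap]; apply: le_trans.
have ge_rf : reflexive (>=%R : rel R) by move=> a; apply: lexx.
apply: (sorted_leq_nth ge_tr ge_rf 0 sl); rewrite ?inE ?leq_addr -?ltn_subRL //.
by rewrite -subn_gt0 (leq_ltn_trans _ il).
Qed.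

Lemma wide_kernel (F : fieldType) q n (M : 'M[F]_(q, n)) : (q < n)%N ->
  exists2 y : 'cV[F]_n, y != 0 & M *m y = 0.
Proof.
move=> qn; have : cokermx M != 0.
  by rewrite -mxrank_eq0 mxrank_coker subn_eq0 -ltnNge (leq_ltn_trans (rank_leq_row M)).
move=> c0; have [j cj] : exists j, col j (cokermx M) != 0.
  apply/existsP; apply: contraNT c0 => /existsPn h; apply/eqP/matrixP => i j.
  by have /negPn/eqP/matrixP/(_ i 0) := h j; rewrite !mxE.
by exists (col j (cokermx M)) => //; rewrite colE mulmxA mulmx_coker mul0mx.
Qed.

Section SingularValues.
Local Open Scope sesquilinear_scope.
Variable R : rcfType.
Local Notation C := R[i].
Local Notation Re := complex.Re.

(* [singvals] of a matrix that already has complex entries. *)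
Definition gram_roots n1 n2 (Z : 'M[C]_(n1, n2)) : seq R :=
  sort >=%R [seq Num.sqrt (Re (spectral_diag (Z^t* *m Z) 0 j)) | j <- enum 'I_n2].

Lemma size_gram_roots n1 n2 (Z : 'M[C]_(n1, n2)) : size (gram_roots Z) = n2.
Proof. by rewrite size_sort size_map size_enum_ord. Qed.

Lemma sorted_gram_roots n1 n2 (Z : 'M[C]_(n1, n2)) : sorted >=%R (gram_roots Z).
Proof. by apply: sort_sorted => x y; apply: le_total. Qed.

Lemma nth_gram_roots_ge0 n1 n2 (Z : 'M[C]_(n1, n2)) k : 0 <= nth 0 (gram_roots Z) k.
Proof.
have [kl|kl] := ltnP k (size (gram_roots Z)); last by rewrite nth_default.
have := mem_nth 0 kl; rewrite mem_sort => /mapP[j _ ->]; exact: sqrtr_ge0.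
Qed.

(** [tau] lists the roots in eigenbasis order; the counting clause transfers positions in the sorted
    sequence to sizes of sets of eigenvectors. *)
Lemma gram_roots_basis n1 n2 (Z : 'M[C]_(n1, n2)) :
  exists (W : 'M[C]_n2) (tau : 'I_n2 -> R),
  [/\ W *m W^t* = 1%:M, W^t* *m W = 1%:M,
      Z^t* *m Z = W *m rdiag (fun j => tau j ^+ 2) *m W^t*, forall j, 0 <= tau j &
      forall P, #|[set j | P (tau j)]| = count P (gram_roots Z)].
Proof.
have [W [W1 W2 BE dE]] := gram_spectral Z.
set d := spectral_diag _ in BE dE.
pose tau j := Num.sqrt (Re (d 0 j)).
exists W, tau; split => // [|j|P]; last 1 first.
- rewrite (permP (permEl (perm_sort _ _))) count_map cardE -size_filter.
  rewrite enumT; congr size; rewrite /enum_mem; apply: eq_filter => j.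
  by rewrite -[LHS]/(j \in [set j | P (tau j)]) inE.
- have -> : rdiag (fun j => tau j ^+ 2) = (Z *m W)^t* *m (Z *m W).
    rewrite BE; congr diag_mx; apply/rowP => j; rewrite mxE sqr_sqrtr dE //.
    exact: rdot_ge0.
  by rewrite trmxC_mul -!mulmxA W2 mulmx1 mulmxA W2 mul1mx.
- exact: sqrtr_ge0.
Qed.

Lemma rdot_gram n1 n2 (Z : 'M[C]_(n1, n2)) (W : 'M[C]_n2) (tau : 'I_n2 -> R)
    (y : 'cV[C]_n2) :
  Z^t* *m Z = W *m rdiag (fun j => tau j ^+ 2) *m W^t* ->
  rdot (Z *m y) (Z *m y) = \sum_j tau j ^+ 2 * sqmod ((W^t* *m y) j 0).
Proof. by move=> E; rewrite rdotMl mulmxA E rdotC -!mulmxA rdotMl rdot_rdiag. Qed.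

Section Compare.
Variables (n1 n2 K : nat) (X N : 'M[C]_(n1, n2)) (U : 'M[C]_(n1, K)).
Variables (V : 'M[C]_(n2, K)) (s : 'I_K -> R).
Hypotheses (H : svd_residual X N U V s) (Kn : (K <= n2)%N).
Local Notation sv := (nth 0 (gram_roots (X + N))).

Lemma rdot_col_unitary (W : 'M[C]_n2) (y : 'cV[C]_n2) : W *m W^t* = 1%:M ->
  rdot y y = \sum_j sqmod ((W^t* *m y) j 0).
Proof. by move=> WW; rewrite -rdot_col rdotMl trmxCK mulmxA WW mul1mx. Qed.

(* Some [y != 0] is orthogonal both to the eigenvectors of [(X + N)^*(X + N)]
   with root below [sv K.-1] and to the [K - 1] columns of [V] other than [i]. *)
Lemma residual_sv_lower i : sv K.-1 <= s i.
Proof.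
have [VV UU XE s0 [UN NV Nb]] := H.
have [W [tau [W1 W2 GE t0 cnt]]] := gram_roots_basis (X + N).
set sK := sv K.-1.
have K0 : (0 < K)%N by case: K i => // -[].
pose S := [set j | tau j < sK].
have cS : (#|S| <= n2 - K)%N.
  rewrite (cnt (fun x => x < sK)) -[n2 in (n2 - _)%N](size_gram_roots (X + N)).
  rewrite -[K in (_ - K)%N](prednK K0).
  apply: sorted_count_lt; first exact: sorted_gram_roots.
  by rewrite size_gram_roots prednK.
pose M := col_mx (rowsub (fun k : 'I_#|S| => enum_val k) (W^t*))
                 (rowsub (fun k : 'I_#|[set~ i]| => enum_val k) (V^t*)).
(* There are at most [(n2 - K) + (K - 1)] equations, fewer than [n2]. *)
have [|y y0 My] := @wide_kernel _ _ _ M.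
  by rewrite cardsC1 card_ord; lia.
move/eqP: My; rewrite mul_col_mx col_mx_eq0 !mul_rowsub_mx.
move=> /andP[/eqP/matrixP hS /eqP/matrixP hV].
have cS0 j : tau j < sK -> (W^t* *m y) j 0 = 0.
  move=> tj; have jS : j \in S by rewrite inE.
  by have := hS (enum_rank_in jS j) 0; rewrite [LHS]mxE enum_rankK_in // => ->;
    rewrite mxE.
have cV0 j : j != i -> (V^t* *m y) j 0 = 0.
  move=> ji; have jS : j \in [set~ i] by rewrite !inE.
  by have := hV (enum_rank_in jS j) 0; rewrite [LHS]mxE enum_rankK_in // => ->;
    rewrite mxE.
have lo : sK ^+ 2 * rdot y y <= rdot ((X + N) *m y) ((X + N) *m y).
  rewrite (rdot_gram y GE) (rdot_col_unitary y W1) mulr_sumr ler_sum // => j _.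
  have [/cS0->|st] := ltP (tau j) sK; first by rewrite sqmod0 !mulr0.
  rewrite ler_wpM2r ?sqmod_ge0 // lerXn2r ?nnegrE //.
  exact: nth_gram_roots_ge0.
(* On [V], [y] has only its [i]-th coefficient, which [X] scales by [s i]; on the rest, [N] has norm
   at most [s i]. *)
have hi : rdot ((X + N) *m y) ((X + N) *m y) <= s i ^+ 2 * rdot y y.
  rewrite (residual_sqr H).
  have := Nb i (y - V *m (V^t* *m y)).
  rewrite rdot_proj // mulmxBr [N *m (V *m _)]mulmxA NV mul0mx subr0 mulrBr.
  have -> : rdot (V^t* *m y) (V^t* *m y) = sqmod ((V^t* *m y) i 0).
    by rewrite rdot_col (bigD1 i) //= big1 ?addr0 // => j /cV0->; rewrite sqmod0.
  rewrite (bigD1 i) //= big1 ?addr0 => [|j /cV0->]; last by rewrite sqmod0 mulr0.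
  by rewrite lerBrDl.
have := le_trans lo hi; rewrite ler_pM2r ?rdot_gt0 //.
by rewrite ler_pXn2r ?nnegrE // nth_gram_roots_ge0.
Qed.

(* By the gap, each column of [V] lies in the span of the at most [K]
   eigenvectors with root above [sv K]; summing the squared coefficients in both
   orders shows that these eigenvectors lie in the span of [V]. *)
Lemma residual_sv_upper : sv K < sv K.-1 -> forall y : 'cV[C]_n2,
  rdot (N *m y) (N *m y) <= sv K ^+ 2 * rdot y y.
Proof.
have [VV UU XE s0 [UN NV Nb]] := H.
have [W [tau [W1 W2 GE t0 cnt]]] := gram_roots_basis (X + N).
set sK := sv K; move=> gap y.
pose S := [set j | sK < tau j].
have cS : (#|S| <= K)%N.
  rewrite (cnt (fun x => sK < x)); apply: sorted_count_gt.
    exact: sorted_gram_roots.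
  by rewrite size_gram_roots.
pose M := W^t* *m V.
have MM : M^t* *m M = 1%:M.
  by rewrite trmxC_mul trmxCK mulmxA -[V^t* *m W *m _]mulmxA W1 mulmx1.
have GV : (X + N)^t* *m (X + N) *m V = V *m rdiag (fun j => s j ^+ 2).
  rewrite -mulmxA mulmxDl NV addr0 trmxCD mulmxDl mulmxA.
  rewrite (residual_gram H) -!mulmxA VV mulmx1 [N^t* *m _]mulmxA.
  have -> : N^t* *m X = 0 by rewrite -(trmxCK X) -trmxC_mul (residual_orthogonal H) trmx0 map_mx0.
  by rewrite mul0mx addr0.
(* [M] intertwines the two diagonal matrices of squares, so a nonzero entry forces [tau t = s i],
   which exceeds [sK] by the gap. *)
have M0 t i : t \notin S -> M t i = 0.
  rewrite inE -leNgt => tS.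
  have : rdiag (fun j => tau j ^+ 2) *m M = M *m rdiag (fun j => s j ^+ 2).
    rewrite -[RHS]mulmxA -GV GE !mulmxA W2 mul1mx.
    by rewrite -[_ *m _ *m V]mulmxA.
  rewrite mul_diag_mx mul_mx_diag => /matrixP/(_ t i); rewrite !mxE => /eqP.
  rewrite mulrC -subr_eq0 -mulrBr mulf_eq0 => /orP[/eqP//|].
  rewrite subr_eq0 (inj_eq (@complexI R)) => /eqP ts; exfalso.
  have : tau t < s i.
    by apply: le_lt_trans tS _; apply: lt_le_trans gap (residual_sv_lower i).
  by rewrite -(ltr_pXn2r (n := 2)) ?nnegrE // ts ltxx.
have Wt t : rdot (col t W) (col t W) = 1.
  have := trmxC_mul_col (col t W) => /matrixP/(_ 0 0); rewrite [RHS]mxE eqxx mulr1n.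
  rewrite colE trmxC_mul -mulmxA [W^t* *m _]mulmxA W2 mul1mx -colE => E.
  apply: complexI; rewrite -E mxE (bigD1 t) //= big1 ?addr0.
    by rewrite !mxE !eqxx /= rmorph1 mulr1.
  by move=> l /negPf lt; rewrite !mxE lt !mulr0.
have Mrow t : rdot (V^t* *m col t W) (V^t* *m col t W) = \sum_i sqmod (M t i).
  rewrite rdot_col; apply: eq_bigr => i _.
  have -> : V^t* *m col t W = col t (M^t*) by rewrite trmxC_mul trmxCK colE mulmxA -colE.
  by rewrite !mxE /sqmod conjCK mulrC.
have Mrow1 t : \sum_i sqmod (M t i) <= 1.
  by rewrite -Mrow -subr_ge0 -{1}(Wt t) -rdot_proj // rdot_ge0.
have Mcol i : \sum_t sqmod (M t i) = 1.
  have /matrixP/(_ i i) := MM; rewrite [RHS]mxE eqxx mulr1n mxE => /(congr1 (@complex.Re R)).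
  rewrite Re_sum /= => <-; apply: eq_bigr => t _; rewrite !mxE.
  by rewrite /sqmod mulrC.
(* At most [K] rows, each of sum at most 1, share the total [K], so each row sum is 1. *)
have full t : t \in S -> \sum_i sqmod (M t i) = 1.
  move=> tS; have tot : \sum_(t in S) (1 - \sum_i sqmod (M t i)) <= 0.
    rewrite sumrB sumr_const.
    have -> : \sum_(t in S) \sum_i sqmod (M t i) = K%:R.
      rewrite exchange_big /= -[in RHS](card_ord K) -sumr_const.
      apply: eq_bigr => i _; rewrite -(Mcol i) [RHS](bigID (mem S)) /=.
      by rewrite [X in _ = _ + X]big1 ?addr0 // => t' /M0->; rewrite sqmod0.
    by rewrite subr_le0 ler_nat.
  have nn t' : t' \in S -> 0 <= 1 - \sum_i sqmod (M t' i) by rewrite subr_ge0.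
  have : \sum_(t in S) (1 - \sum_i sqmod (M t i)) == 0.
    by rewrite eq_le tot sumr_ge0.
  rewrite psumr_eq0 // => /allP/(_ t (mem_index_enum _))/implyP/(_ tS).
  by rewrite subr_eq0 => /eqP.
set y1 := y - V *m (V^t* *m y).
have Vy1 : V^t* *m y1 = 0 by rewrite mulmxBr [V^t* *m (V *m _)]mulmxA VV mul1mx subrr.
have Ny1 : N *m y = N *m y1 by rewrite mulmxBr [N *m (V *m _)]mulmxA NV mul0mx subr0.
have y1y : rdot y1 y1 <= rdot y y by rewrite rdot_proj // gerBl rdot_ge0.
(* A full row puts the eigenvector in the span of [V], to which [y1] is orthogonal. *)
have c0 t : t \in S -> (W^t* *m y1) t 0 = 0.
  move=> tS; have Wt0 : col t W = V *m (V^t* *m col t W).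
    by apply/eqP; rewrite -subr_eq0 -rdot_eq0 rdot_proj // Wt Mrow full // subrr.
  suff : row t (W^t* *m y1) = 0 by move=> /matrixP/(_ 0 0); rewrite !mxE.
  rewrite row_mul; have -> : row t (W^t*) = (col t W)^t*.
    by apply/matrixP => i j; rewrite !mxE.
  by rewrite Wt0 !trmxC_mul -!mulmxA Vy1 !mulmx0.
rewrite Ny1; apply: (@le_trans _ _ (rdot ((X + N) *m y1) ((X + N) *m y1))).
  rewrite (residual_sqr H) lerDr sumr_ge0 // => j _.
  by rewrite mulr_ge0 ?sqr_ge0 ?sqmod_ge0.
apply: (@le_trans _ _ (sK ^+ 2 * rdot y1 y1)); last first.
  by rewrite ler_wpM2l ?sqr_ge0.
rewrite (rdot_gram y1 GE) (rdot_col_unitary y1 W1) mulr_sumr ler_sum // => t _.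
have [/c0->|] := boolP (t \in S); first by rewrite sqmod0 !mulr0.
rewrite inE -leNgt => tS.
by rewrite ler_wpM2r ?sqmod_ge0 // lerXn2r ?nnegrE // nth_gram_roots_ge0.
Qed.

End Compare.
End SingularValues.

(** * Comparison of two approximations with their residuals *)

Section Pair.
Local Open Scope sesquilinear_scope.
Variable R : rcfType.
Local Notation C := R[i].
Local Notation Re := complex.Re.

Lemma rdot_cols p K (A B : 'M[C]_(p, K)) (s : 'I_K -> R) :
  rdot A (B *m rdiag s) = \sum_j s j * rdot (col j A) (col j B).
Proof.
rewrite rdotE exchange_big; apply: eq_bigr => j _.
rewrite rdotE mulr_sumr; apply: eq_bigr => i _.
by rewrite big_ord1 mul_mx_diag !mxE rmorphM /= conj_RC mulrA
  [_ * (s j)%:C%C]mulrC ReZ.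
Qed.

Lemma rdot_svd n1 n2 K (U U' : 'M[C]_(n1, K)) (V V' : 'M[C]_(n2, K)) s s' :
  rdot (U *m rdiag s *m V^t*) (U' *m rdiag s' *m V'^t*) =
  \sum_i \sum_j s i * s' j * Re ((V^t* *m V') i j * ((U^t* *m U') i j)^*).
Proof.
have -> : rdot (U *m rdiag s *m V^t*) (U' *m rdiag s' *m V'^t*) =
    rdot (rdiag s *m (V^t* *m V')) (U^t* *m U' *m rdiag s').
  rewrite -[U *m _ *m _]mulmxA [LHS]rdotMl [X in rdot _ X]mulmxA [LHS]rdotC.
  rewrite [LHS]rdotMr trmxCK [LHS]rdotC.
  by rewrite -!mulmxA.
rewrite rdotE; apply: eq_bigr => i _; apply: eq_bigr => j _.
move: (V^t* *m V') (U^t* *m U') => a c.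
rewrite mul_diag_mx mul_mx_diag !mxE rmorphM /= conj_RC.
rewrite (_ : _ * _ = (s i * s' j)%:C%C * (a i j * (c i j)^*)) ?ReZ //.
by rewrite rmorphM /=; ring.
Qed.

Lemma rdot_col_gram n K (A : 'M[C]_(n, K)) (e : 'I_K -> R) j :
  A^t* *m A = rdiag e -> rdot (col j A) (col j A) = e j.
Proof.
move=> /matrixP/(_ j j); rewrite [RHS]mxE [in RHS]mxE eqxx mulr1n => E.
apply: complexI; rewrite -E.
have /matrixP/(_ 0 0) := trmxC_mul_col (col j A).
rewrite [in RHS]mxE eqxx mulr1n => <-; rewrite !mxE.
by apply: eq_bigr => i _; rewrite !mxE.
Qed.

Lemma sqmod_conj (z : C) : sqmod z^* = sqmod z.
Proof. by rewrite /sqmod conjCK mulrC. Qed.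

(** With [c = A^t* *m v], the left side is [|v|^2 - 2 |c|^2] plus a sum of [|c_k|^2] with weights 0
    or 1. This replaces [rdot_proj] for [U], which may have zero columns. *)
Lemma rdot_partial_isometry n K (A : 'M[C]_(n, K)) (e : 'I_K -> bool)
    (v : 'cV[C]_n) : A^t* *m A = rdiag (fun k => (e k)%:R) ->
  rdot (v - A *m (A^t* *m v)) (v - A *m (A^t* *m v)) <=
  rdot v v - rdot (A^t* *m v) (A^t* *m v).
Proof.
move=> AA; move E : (A^t* *m v) => c.
rewrite rdotBr !rdotBl [rdot v (A *m c)]rdotC !rdotMl E [_^t* *m (_ *m c)]mulmxA AA.
rewrite [rdot c (rdiag _ *m c)]rdotC rdot_rdiag.
have : \sum_k (e k)%:R * sqmod (c k 0) <= rdot c c.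
  rewrite rdot_col ler_sum // => k _.
  by case: (e k); rewrite ?mul1r ?mul0r ?sqmod_ge0.
lra.
Qed.

Lemma rdiag_true K : rdiag (fun=> true%:R) = 1%:M :> 'M[C]_K.
Proof. by apply/matrixP => k l; rewrite !mxE. Qed.

Lemma rdot_trmxC_col p K (A B : 'M[C]_(p, K)) j :
  rdot (A^t* *m col j B) (A^t* *m col j B) = \sum_i sqmod ((A^t* *m B) i j).
Proof.
rewrite colE mulmxA -colE rdot_col; apply: eq_bigr => i _; congr sqmod.
by rewrite mxE.
Qed.

(** Bessel's inequality for the columns of [B], of norm at most 1. *)
Lemma gram_col_le1 p K (A B : 'M[C]_(p, K)) (e f : 'I_K -> bool) :
  A^t* *m A = rdiag (fun k => (e k)%:R) -> B^t* *m B = rdiag (fun k => (f k)%:R) ->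
  forall j, \sum_i sqmod ((A^t* *m B) i j) <= 1.
Proof.
move=> AA BB j; rewrite -rdot_trmxC_col;
  apply: (@le_trans _ _ (rdot (col j B) (col j B))).
  by rewrite -subr_ge0; apply: le_trans (rdot_ge0 _) (rdot_partial_isometry _ AA).
by rewrite (rdot_col_gram _ BB); case: (f j).
Qed.

(** [N] only sees the components [u'] and [v'] off [U] and [V]; there [|r u' - N v'|^2 >= 0] gives
    [2 <N v', u'> <= r (|u'|^2 + |v'|^2)] after division by [r], whence the separate case
    [r = 0]. *)
Lemma rdot_residual_le n1 n2 K (X N : 'M[C]_(n1, n2)) (U : 'M[C]_(n1, K))
    (V : 'M[C]_(n2, K)) (s : 'I_K -> R) (r : R) (u : 'cV[C]_n1) (v : 'cV[C]_n2) :
  svd_residual X N U V s -> 0 <= r ->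
  (forall y : 'cV[C]_n2, rdot (N *m y) (N *m y) <= r ^+ 2 * rdot y y) ->
  rdot (N *m v) u <= r * ((rdot u u - rdot (U^t* *m u) (U^t* *m u)) +
                        (rdot v v - rdot (V^t* *m v) (V^t* *m v))) / 2.
Proof.
move=> [VV UU _ _ [UN NV _]] r0 Nr.
set u' := u - U *m (U^t* *m u); set v' := v - V *m (V^t* *m v).
have uu : rdot u' u' <= rdot u u - rdot (U^t* *m u) (U^t* *m u).
  exact: rdot_partial_isometry UU.
have vv : rdot v' v' = rdot v v - rdot (V^t* *m v) (V^t* *m v) by exact: rdot_proj.
have -> : rdot (N *m v) u = rdot (N *m v') u'.
  rewrite mulmxBr [N *m (V *m _)]mulmxA NV mul0mx subr0 [RHS]rdotBr.
  rewrite [X in _ = _ - X]rdotC [X in _ = _ - X]rdotMl [U^t* *m (N *m v)]mulmxA UN.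
  by rewrite mul0mx rdot0r subr0.
apply: (@le_trans _ _ (r * (rdot u' u' + rdot v' v') / 2)); last first.
  have := ler_wpM2l r0 (lerD uu (lexx (rdot v' v'))); rewrite [in leRHS]vv; lra.
clearbody u' v'.
have := Nr v'; move: r0; rewrite le_eqVlt => /orP[/eqP<-|r0 b].
  rewrite expr0n !mul0r => h; have /eqP : rdot (N *m v') (N *m v') == 0.
    by rewrite eq_le h rdot_ge0.
  by move=> /eqP; rewrite rdot_eq0 => /eqP->; rewrite rdot0l.
have := rdot_ge0 (r%:C%C *: u' - N *m v').
rewrite rdotBr !rdotBl !rdotZr !rdotZl [rdot u' (N *m v')]rdotC => h.
have : 2 * rdot (N *m v') u' <= r * (rdot u' u' + rdot v' v').
  rewrite -(ler_pM2l r0); nra.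
lra.
Qed.

Section TwoResiduals.
Variables (n1 n2 K : nat) (X N X' N' : 'M[C]_(n1, n2)).
Variables (U U' : 'M[C]_(n1, K)) (V V' : 'M[C]_(n2, K)) (s s' : 'I_K -> R).

(** [<N, X'>] is the sum of [s' j * <N v'_j, u'_j>], and [rdot_residual_le] bounds each term by a
    column defect of the averaged squared overlaps. *)
Lemma rdot_residual_svd r :
  svd_residual X N U V s -> svd_residual X' N' U' V' s' -> 0 <= r ->
  (forall y : 'cV[C]_n2, rdot (N *m y) (N *m y) <= r ^+ 2 * rdot y y) ->
  rdot N X' <= r * \sum_j (1 - \sum_i
     (sqmod ((U^t* *m U') i j) + sqmod ((V^t* *m V') i j)) / 2) * s' j.
Proof.
move=> H [VV' UU' -> s0' _] r0 Nr.
rewrite rdotC rdotMr trmxCK rdotC rdot_cols mulr_sumr ler_sum // => j _.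
have colU : rdot (col j U') (col j U') <= 1.
  by rewrite (rdot_col_gram _ UU'); case: (_ != 0).
have colV : rdot (col j V') (col j V') <= 1.
  by rewrite -rdiag_true in VV'; rewrite (rdot_col_gram _ VV').
rewrite [leRHS]mulrA [leRHS]mulrC ler_wpM2l //.
have -> : col j (N *m V') = N *m col j V' by rewrite !colE mulmxA.
apply: le_trans (rdot_residual_le (col j U') (col j V') H r0 Nr) _.
rewrite -mulrA ler_wpM2l //.
rewrite !rdot_trmxC_col -mulr_suml big_split /=; lra.
Qed.

Lemma rdot_svd_norm : svd_residual X N U V s -> rdot X X = \sum_i s i ^+ 2.
Proof.
case=> VV UU -> _ _; rewrite rdot_svd VV UU; apply: eq_bigr => i _.
rewrite (bigD1 i) //= big1 ?addr0 => [|j ji]; last first.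
  by rewrite !mxE eq_sym (negPf ji) mul0r mulr0.
rewrite !mxE !eqxx !mulr1n mul1r Re_conjc /=.
by have [->|] := eqVneq (s i) 0; rewrite /= ?mulr1 // mulr0 expr0n.
Qed.

End TwoResiduals.

(** [coupling_bound] applies with [e = |X' - X|^2]: the overlaps satisfy [mu <= w] by the
    arithmetic-geometric mean inequality and Bessel bounds the sums of [w]. [N] is controlled by
    [r], while [N'] is controlled by every [s' j]. *)
Lemma residual_uniqueness n1 n2 K (X N X' N' : 'M[C]_(n1, n2))
    (U U' : 'M[C]_(n1, K)) (V V' : 'M[C]_(n2, K)) (s s' : 'I_K -> R) (d r : R) :
  svd_residual X N U V s -> svd_residual X' N' U' V' s' ->
  0 < d -> 0 <= r -> (forall i, 0 < s i) -> (forall i, r < (2 * d - 1) * s i) ->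
  (forall y : 'cV[C]_n2, rdot (N *m y) (N *m y) <= r ^+ 2 * rdot y y) ->
  d * rdot (X' - X) (X' - X) <= rdot N X' + rdot N' X -> X' = X.
Proof.
move=> H H' d0 r0 s0 rs Nr Hd.
have [VV UU XE _ [_ _ _]] := H; have [VV' UU' XE' s0' [_ _ Nb']] := H'.
rewrite -rdiag_true in VV VV'.
pose Mu := U^t* *m U'; pose Mv := V^t* *m V'.
pose w i j := (sqmod (Mu i j) + sqmod (Mv i j)) / 2.
have E : rdot (X' - X) (X' - X) = \sum_i s i ^+ 2 + \sum_j s' j ^+ 2 -
    2 * \sum_i \sum_j s i * s' j * Re (Mv i j * (Mu i j)^*).
  rewrite rdotBr !rdotBl (rdot_svd_norm H) (rdot_svd_norm H') [rdot X' X]rdotC.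
  by rewrite {1 2}XE {1 2}XE' rdot_svd; ring.
have sqT i j : sqmod ((U'^t* *m U) j i) = sqmod (Mu i j).
  have -> : (U'^t* *m U) j i = (Mu i j)^*.
    by rewrite -[U in LHS]trmxCK -trmxC_mul !mxE.
  exact: sqmod_conj.
have sqT' i j : sqmod ((V'^t* *m V) j i) = sqmod (Mv i j).
  have -> : (V'^t* *m V) j i = (Mv i j)^*.
    by rewrite -[V in LHS]trmxCK -trmxC_mul !mxE.
  exact: sqmod_conj.
apply/eqP; rewrite -subr_eq0 -rdot_eq0 eq_le rdot_ge0 andbT.
move: Hd; rewrite E => Hd.
apply: (@coupling_bound R K d r (rdot N X') (rdot N' X) s s' w
  (fun i j => Re (Mv i j * (Mu i j)^*))) => //.
- move=> i j; rewrite /w /sqmod.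
  case: (Mu i j) (Mv i j) => x y [u v] /=.
  have := sqr_ge0 (u - x); have := sqr_ge0 (v - y); nra.
- move=> i; rewrite /w -mulr_suml big_split /=.
  have := gram_col_le1 UU' UU i; rewrite (eq_bigr _ (fun j _ => sqT i j)).
  have := gram_col_le1 VV' VV i; rewrite (eq_bigr _ (fun j _ => sqT' i j)).
  lra.
- move=> j; rewrite /w -mulr_suml big_split /=.
  have := gram_col_le1 UU UU' j; have := gram_col_le1 VV VV' j.
  rewrite -/Mu -/Mv; lra.
- by move=> i j; rewrite divr_ge0 ?addr_ge0 ?sqmod_ge0 ?ler0n.
- exact: rdot_residual_svd H H' r0 Nr.
(* The roles are swapped here; the overlaps become conjugates, of equal modulus. *)
- move=> j; apply: le_trans (rdot_residual_svd H' H (s0' j) (Nb' j)) _.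
  rewrite ler_wpM2l // ler_sum // => i _; rewrite ler_wpM2r ?(ltW (s0 i)) //.
  by rewrite lerD2l lerN2 ler_sum // => k _; rewrite sqT sqT'.
Qed.

End Pair.

(** * Passage from either scalar field to complex matrices *)

Section Complexify.
Local Open Scope classical_set_scope.
Variables (R : realType) (k : real_or_complex).
Local Notation F := (scal R k).
Local Notation C := R[i].

Definition real_scalars := if k is RealScalars then true else false.

Definition toC p q (X : 'M[F]_(p, q)) : 'M[C]_(p, q) :=
  map_mx (@to_complex R k) X.

Definition emb : R -> F :=
  match k return R -> scal R k with
  | RealScalars => fun x => x
  | ComplexScalars => fun x => (x%:C)%C
  end.

Lemma to_complexD (x y : F) : to_complex (x + y) = to_complex x + to_complex y.
Proof. by rewrite /to_complex; case: k x y => x y //; rewrite rmorphD. Qed.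

Lemma to_complexN (x : F) : to_complex (- x) = - to_complex x.
Proof. by rewrite /to_complex; case: k x => x //; rewrite rmorphN. Qed.

Lemma to_complexM (x y : F) : to_complex (x * y) = to_complex x * to_complex y.
Proof. by rewrite /to_complex; case: k x y => x y //; rewrite rmorphM. Qed.

Lemma to_complex0 : to_complex (0 : F) = 0.
Proof. by rewrite /to_complex; case: k. Qed.

Lemma to_complex_inj : injective (@to_complex R k).
Proof. by rewrite /to_complex; case: k => x y //; apply: complexI. Qed.

Lemma to_complex_emb t : to_complex (emb t) = (t%:C)%C.
Proof. by rewrite /to_complex /emb; case: k. Qed.

Lemma to_complex_conjs (x : F) : to_complex (conjs x) = (to_complex x)^*%R.
Proof. by rewrite /to_complex /conjs; case: k x => x //; rewrite conj_RC. Qed.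

Lemma modulus_sqr (x : F) :
  modulus x ^+ 2 = sqmod (to_complex x).
Proof.
rewrite /sqmod /modulus /to_complex; case: k x => [x|[x y]] /=.
  by rewrite real_normK ?num_real //; ring.
by rewrite sqr_sqrtr ?addr_ge0 ?sqr_ge0 //; ring.
Qed.

Lemma toCD p q (X Y : 'M[F]_(p, q)) : toC (X + Y) =
  toC X + toC Y.
Proof. by apply/matrixP => i j; rewrite !mxE to_complexD. Qed.

Lemma toCN p q (X : 'M[F]_(p, q)) : toC (- X) = - toC X.
Proof. by apply/matrixP => i j; rewrite !mxE to_complexN. Qed.

Lemma toCB p q (X Y : 'M[F]_(p, q)) : toC (X - Y) =
  toC X - toC Y.
Proof. by rewrite toCD toCN. Qed.

Lemma toCZ p q t (X : 'M[F]_(p, q)) : toC (emb t *: X) =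
  (t%:C)%C *: toC X.
Proof. by apply/matrixP => i j; rewrite !mxE to_complexM to_complex_emb. Qed.

Lemma toC0 p q : toC (0 : 'M[F]_(p, q)) = 0.
Proof. by apply/matrixP => i j; rewrite !mxE to_complex0. Qed.

Lemma toC_inj p q : injective (@toC p q).
Proof.
move=> X Y /matrixP XY; apply/matrixP => i j; apply: to_complex_inj.
by have := XY i j; rewrite !mxE.
Qed.

Lemma rank_toC p q (X : 'M[F]_(p, q)) : \rank (toC X) = \rank X.
Proof.
rewrite /toC /to_complex; case: k X => X;
  first exact: (mxrank_map (real_complex R)).
by congr (\rank _); apply/matrixP => i j; rewrite mxE.
Qed.

Lemma over_toC p q (X : 'M[F]_(p, q)) : over real_scalars (toC X).
Proof.
rewrite /toC /to_complex /real_scalars; case: k X => X // _.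
by apply/matrixP => i j; rewrite !mxE conj_RC.
Qed.

Lemma toC_surj p q (W : 'M[C]_(p, q)) : over real_scalars W ->
  exists X : 'M[F]_(p, q), W = toC X.
Proof.
rewrite /toC /to_complex /real_scalars; case: k => oW.
  exists (map_mx (@complex.Re R) W); apply/matrixP => i j; rewrite !mxE.
  exact/over_entry/oW.
by exists W; apply/matrixP => i j; rewrite mxE.
Qed.

Lemma fnorm_sqr p q (X : 'M[F]_(p, q)) :
  fnorm X ^+ 2 = rdot (toC X) (toC X).
Proof.
rewrite /fnorm sqr_sqrtr; last first.
  by apply: sumr_ge0 => i _; apply: sumr_ge0 => j _; apply: sqr_ge0.
rewrite rdotE; apply: eq_bigr => i _; apply: eq_bigr => j _.
by rewrite modulus_sqr !mxE.
Qed.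

Lemma Re_inner p q (X Y : 'M[F]_(p, q)) :
  complex.Re (to_complex (inner X Y)) = rdot (toC X) (toC Y).
Proof.
rewrite /inner (big_morph _ to_complexD to_complex0) Re_sum rdotE.
apply: eq_bigr => i _; rewrite (big_morph _ to_complexD to_complex0) Re_sum.
by apply: eq_bigr => j _; rewrite to_complexM to_complex_conjs !mxE.
Qed.

Lemma fnorm_gt0 p q (X : 'M[F]_(p, q)) : X != 0 -> 0 < fnorm X.
Proof.
move=> X0; rewrite lt_neqAle sqrtr_ge0 andbT eq_sym -sqrf_eq0 fnorm_sqr rdot_eq0.
by apply: contra_neq X0 => h; apply: toC_inj; rewrite h toC0.
Qed.

Lemma emb_small (e : F) : 0 < e -> exists2 r : R, 0 < r & emb r <= e.
Proof.
rewrite /emb; case: k e => [e e0|[x y]]; first by exists e.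
rewrite ltcE /= => /andP[/eqP-> x0]; exists x => //.
Qed.

Lemma norm_emb (t : R) (x : F) : 0 <= t ->
  `|emb t * x| = emb (t * modulus x).
Proof.
rewrite /emb /modulus; case: k x => x t0; first by rewrite normrM ger0_norm.
by rewrite normrM rmorphM; congr (_ * _); rewrite ger0_norm // ler0c.
Qed.

Lemma emb_lt (x y : R) : x < y -> emb x < emb y.
Proof. by rewrite /emb; case: k => //; rewrite ltcR. Qed.

Lemma modulus_le_fnorm p q (X : 'M[F]_(p, q)) i j : modulus (X i j) <= fnorm X.
Proof.
rewrite -(ler_pXn2r (n := 2)) ?nnegrE ?sqrtr_ge0 //; last first.
  by rewrite /modulus; case: k (X i j) => [x|[x y]];
    rewrite ?normr_ge0 // sqrtr_ge0.
rewrite /fnorm sqr_sqrtr; last first.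
  by apply: sumr_ge0 => i' _; apply: sumr_ge0 => j' _; apply: sqr_ge0.
rewrite (bigD1 i) //= (bigD1 j) //= -addrA lerDl addr_ge0 //.
  by apply: sumr_ge0 => j' _; apply: sqr_ge0.
by apply: sumr_ge0 => i' _; apply: sumr_ge0 => j' _; apply: sqr_ge0.
Qed.

(** Neighbourhoods are entrywise with a radius in the scalar field; [emb_small] makes that radius
    real, and each entry is dominated by the Frobenius norm. *)
Lemma dnbhs_ray p q (X H : 'M[F]_(p, q)) (V : set 'M[F]_(p, q)) : H != 0 ->
  X^' V -> exists2 d : R, 0 < d & forall t, 0 < t < d -> V (X + emb t *: H).
Proof.
move=> H0; rewrite /dnbhs /within /= => /nbhs_ballP[e /= e0 eV].
have [r r0 re] := emb_small e0; have h0 := fnorm_gt0 H0.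
exists (r / fnorm H) => [|t /andP[t0]]; first exact: divr_gt0.
rewrite ltr_pdivlMr // => tr; apply: eV.
  split=> // i j; rewrite /ball /= !mxE opprD addrA subrr sub0r normrN.
  rewrite norm_emb ?ltW //; apply: lt_le_trans re; apply: emb_lt.
  by apply: le_lt_trans tr; rewrite ler_pM2l // modulus_le_fnorm.
apply/eqP => /(congr1 (fun Y => toC (Y - X))); rewrite addrAC subrr add0r toCZ.
move/eqP; rewrite toC0 scaler_eq0 => /orP[/eqP[/eqP]|].
  by rewrite gt_eqF.
by rewrite -rdot_eq0 -fnorm_sqr sqrf_eq0 gt_eqF.
Qed.

End Complexify.

(** * From stationarity to best approximation *)

Section Stationary.
Local Open Scope classical_set_scope.
Variables (R : realType) (k : real_or_complex) (n1 n2 K : nat).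
Local Notation F := (scal R k).
Local Notation iota := (indic_fun R (@rank_le R k n1 n2 K)).

Lemma indic_rank_le (X : 'M[F]_(n1, n2)) : (\rank X <= K)%N -> iota X = 0%E.
Proof. by move=> rX; rewrite /indic_fun; case: asboolP. Qed.

(** Take [X] itself in the outer supremum: [S2] of a nonnegative function is at most 0. *)
Lemma Q2_indic_ge0 (X : 'M[F]_(n1, n2)) : (0 <= Q2 iota X)%E.
Proof.
apply: le_trans (ereal_sup_ubound _); last by exists X.
have -> : fnorm (X - X) = 0.
  by apply/eqP; rewrite -sqrf_eq0 fnorm_sqr toCB subrr rdot0l.
rewrite expr0n /= sube0 oppe_ge0; apply: ge_ereal_sup => _ [U _ <-].
rewrite sube_le0; apply: (@le_trans _ _ 0%E); last by rewrite lee_fin sqr_ge0.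
by rewrite oppe_le0 /indic_fun; case: asboolP.
Qed.

(* With [V = (1 - t) X + t W], use
   [(1 - t)|X - Y|^2 + t|W - Y|^2 = |V - Y|^2 + t(1 - t)|W - X|^2] for every [Y]. *)
Lemma Q2_indic_segment (X W : 'M[F]_(n1, n2)) (t : R) :
  (\rank X <= K)%N -> (\rank W <= K)%N -> 0 <= t <= 1 ->
  (Q2 iota (X + emb k t *: (W - X)) <=
     (t * (1 - t) * fnorm (W - X) ^+ 2)%:E)%E.
Proof.
move=> rX rW /andP[t0 t1]; apply: ge_ereal_sup => _ [Y _ <-].
have low (U : 'M[F]_(n1, n2)) : (\rank U <= K)%N ->
    ((- fnorm (U - Y) ^+ 2)%:E <= S2 iota Y)%E.
  move=> rU; apply: le_trans (ereal_sup_ubound _); last by exists U.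
  by rewrite indic_rank_le // oppe0 add0e EFinN.
have := low _ rW; have := low _ rX; case: (S2 iota Y) => [a||] //=; last first.
  by move=> _ _; rewrite addNye leNye.
rewrite !lee_fin => aX aW.
move: aX aW; rewrite !fnorm_sqr => aX aW.
set E := rdot _ _ in aX; set E' := rdot _ _ in aW; set G := rdot _ _;
  set D := rdot _ _.
have -> : G = (1 - t) * E + t * E' - t * (1 - t) * D.
  rewrite /G /E /E' /D !(toCB, toCD, toCZ).
  rewrite !(rdotBl, rdotBr, rdotDl, rdotDr, rdotZl, rdotZr).
  rewrite [rdot (toC Y) (toC X)]rdotC [rdot (toC W) (toC X)]rdotC.
  rewrite [rdot (toC Y) (toC W)]rdotC; ring.
nra.
Qed.

Variables (m : nat) (A : {linear 'M[F]_(n1, n2) -> 'cV[F]_m}) (b : 'cV[F]_m).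
Variable X : 'M[F]_(n1, n2).
Hypothesis rX : (\rank X <= K)%N.

Lemma RKreg_rank_le : RKreg K A b X = (fnorm (A X - b) ^+ 2)%:E.
Proof.
rewrite /RKreg; suff -> : Q2 iota X = 0%E by rewrite add0e.
apply/eqP; rewrite eq_le Q2_indic_ge0 andbT.
have := @Q2_indic_segment X X 0 rX rX.
by rewrite subrr scaler0 addr0 !mul0r lexx ler01; apply.
Qed.

(* [X] is a best rank-K approximation of [X - A^*A X + A^*b], with the squares
   expanded. *)
Lemma stationary_best (W : 'M[F]_(n1, n2)) :
  stationary (RKreg K A b) X -> (\rank W <= K)%N ->
  2 * rdot (toC (W - X)) (toC (adj A b - adj A (A X))) <=
  rdot (toC (W - X)) (toC (W - X)).
Proof.
move=> stX rW; have seg t := @Q2_indic_segment X W t rX rW.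
move: (W - X) seg => {W rW} H seg.
have -> : rdot (toC H) (toC (adj A b - adj A (A X))) =
    rdot (toC (A H)) (toC (b - A X)).
  by rewrite !toCB !rdotBr -!Re_inner !adjP.
set I := rdot _ (toC (b - _)); rewrite leNgt; apply/negP => ltI.
have H0 : H != 0.
  by apply/eqP => H0; move: ltI; rewrite /I H0 linear0 !toC0 !rdot0l mulr0 ltxx.
have h0 := fnorm_gt0 H0; set h := fnorm H in h0.
set D := rdot _ _ in ltI; have Dh : D = h ^+ 2 by rewrite /D -fnorm_sqr.
set B := rdot (toC (A H)) (toC (A H)).
have B0 : 0 <= B := rdot_ge0 _.
(* Along [X + t H] the difference quotient is at most [((1 - t) D + t B - 2 I) / h], which tends to
   [(D - 2 I) / h < 0]; [c] is half that limit. *)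
pose c := (D - 2 * I) / (2 * h).
have c0 : c < 0 by rewrite pmulr_llt0 ?invr_gt0 ?mulr_gt0 // subr_lt0.
have : (0 <= c%:E)%E; last by rewrite lee_fin leNgt c0.
apply: (le_trans stX); rewrite limf_einfE; apply: ge_ereal_sup => _ [V XV <-].
have [d d0 dV] := dnbhs_ray H0 XV.
(* For [t <= t0] the term [t * B] is at most [(2 * I - D) / 2], so the quotient is below [c]. *)
pose t0 := (2 * I - D) / (2 * (B + 1)).
have t00 : 0 < t0 by rewrite divr_gt0 ?subr_gt0 // mulr_gt0 // ltr_wpDl.
pose t := Num.min (d / 2) (Num.min 1 t0).
have t_gt0 : 0 < t by rewrite !lt_min divr_gt0 // ltr01.
have td : t < d.
  rewrite gt_min; apply/orP; left; lra.
have t1 : t <= 1 by rewrite /t !ge_min lexx !orbT.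
have tt0 : t <= t0 by rewrite /t !ge_min lexx !orbT.
apply: ereal_inf_le; exists
  ((RKreg K A b (X + emb k t *: H) - RKreg K A b X) *
   (fnorm (X + emb k t *: H - X))^-1%:E)%E.
  by exists (X + emb k t *: H) => //; apply: dV; rewrite t_gt0.
have -> : fnorm (X + emb k t *: H - X) = t * h.
  apply/eqP; rewrite -(eqrXn2 (n := 2)) ?sqrtr_ge0 //;
    last by rewrite mulr_ge0 ?ltW.
  rewrite fnorm_sqr addrAC subrr add0r toCZ rdotZl rdotZr exprMn /h fnorm_sqr.
  by apply/eqP; ring.
rewrite RKreg_rank_le.
have gle : (RKreg K A b (X + emb k t *: H) <=
    (t * (1 - t) * D + fnorm (A (X + emb k t *: H) - b) ^+ 2)%:E)%E.
  rewrite /RKreg EFinD leeD // Dh; apply: seg.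
  by rewrite ltW.
apply: (@le_trans _ _ ((t * (1 - t) * D + fnorm (A (X + emb k t *: H) - b) ^+ 2
   - fnorm (A X - b) ^+ 2) * (t * h)^-1)%:E).
  rewrite [leRHS]EFinM lee_wpmul2r ?lee_fin ?invr_ge0 ?mulr_ge0 ?(ltW t_gt0) ?(ltW h0) //.
  by rewrite EFinB leeB.
rewrite lee_fin linearD linearZ /= !fnorm_sqr.
have -> : toC (A X + emb k t *: A H - b) = (t%:C)%C *: toC (A H) - toC (b - A X).
  by rewrite !(toCB, toCD, toCZ) opprB addrCA addrA.
have -> : toC (A X - b) = - toC (b - A X) by rewrite -toCN opprB.
rewrite rdotNl rdotNr opprK rdotBl !rdotBr !rdotZl !rdotZr -/B.
rewrite [rdot (toC (b - A X)) _]rdotC -/I.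
rewrite ler_pdivrMr ?mulr_gt0 //.
have -> : c * (t * h) = t * (D - 2 * I) / 2 by rewrite /c; field; rewrite gt_eqF.
have : t * (B + 1) <= (2 * I - D) / 2.
  rewrite -ler_pdivlMr ?ltr_wpDl //; apply: le_trans tt0 _.
  by rewrite /t0 invfM mulrA.
have D0 : 0 <= D := rdot_ge0 _.
nra.
Qed.

Lemma stationary_residual : (K <= n2)%N -> stationary (RKreg K A b) X ->
  exists U V s,
    @svd_residual R n1 n2 K (toC X) (toC (adj A b - adj A (A X))) U V s.
Proof.
move=> Kn stX; apply: best_svd (over_toC X) (over_toC _) _ _.
  by rewrite rank_toC rX.
move=> _ /toC_surj[W ->] rW; rewrite -toCB; apply: stationary_best => //.
by rewrite -rank_toC.
Qed.

End Stationary.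

(** * The lower restricted isometry inequality *)

Section Isometry.
Local Open Scope classical_set_scope.
Variables (R : realType) (k : real_or_complex) (n1 n2 m : nat).
Variable A : {linear 'M[scal R k]_(n1, n2) -> 'cV[scal R k]_m}.

Lemma lower_ric_le J (E : 'M[scal R k]_(n1, n2)) : (\rank E <= J)%N ->
  (1 - lower_ric A J) * fnorm E ^+ 2 <= fnorm (A E) ^+ 2.
Proof.
move=> rE; have [->|E0] := eqVneq E 0.
  by rewrite linear0 !fnorm_sqr !toC0 !rdot0l mulr0.
rewrite -ler_pdivlMr ?exprn_gt0 ?fnorm_gt0 // /lower_ric opprB addrC subrK.
apply: ge_inf; last by exists E.
by exists 0 => _ [Y _ <-]; rewrite divr_ge0 ?sqr_ge0.
Qed.

End Isometry.

(** * Uniqueness of the stationary point of low rank *)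

Theorem theorem6p1 (R : realType) (k : real_or_complex) (n1 n2 m K : nat)
    (A : {linear 'M[scal R k]_(n1, n2) -> 'cV[scal R k]_m})
    (b : 'cV[scal R k]_m) (X' : 'M[scal R k]_(n1, n2)) :
  (1 <= K < minn n1 n2)%N ->
  stationary (RKreg K A b) X' ->
  (\rank X' <= K)%N ->
  let Z' := X' - adj A (A X') + adj A b in
  singval Z' K.+1 < (1 - 2 * lower_ric A (2 * K)) * singval Z' K ->
  forall X'' : 'M[scal R k]_(n1, n2),
    stationary (RKreg K A b) X'' -> (\rank X'' <= K)%N -> X'' = X'.
Proof.
move=> /andP[K0]; rewrite leq_min => /andP[_ Kn] st1 r1 Z' gap X'' st2 r2.
have {}Kn : (K <= n2)%N by apply: ltnW.
have [U [V [s H]]] := stationary_residual r1 Kn st1.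
have [U' [V' [s' H']]] := stationary_residual r2 Kn st2.
set N := toC (adj A b - adj A (A X')) in H; set N' := toC (adj A b - _) in H'.
have ZE : toC Z' = toC X' + N by rewrite /N -toCD; congr toC; rewrite addrA addrAC.
set d := lower_ric A (2 * K) in gap.
(* [nth] counts from 0, so sigma_{K+1} and sigma_K are [sv K] and [sv K.-1]. *)
pose sv := nth 0 (gram_roots (toC X' + N)).
have {}gap : sv K < (1 - 2 * d) * sv K.-1 by rewrite /sv -ZE; exact: gap.
have svK0 : 0 <= sv K := nth_gram_roots_ge0 _ _.
have svK1 : 0 <= sv K.-1 := nth_gram_roots_ge0 _ _.
have svK1p : 0 < sv K.-1.
  rewrite lt_neqAle svK1 andbT; apply: contraTneq gap => <-.
  by rewrite mulr0 -leNgt.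
have d2 : 0 < 1 - 2 * d.
  by rewrite -(pmulr_lgt0 _ svK1p) (le_lt_trans svK0).
have ssv i : sv K.-1 <= s i := residual_sv_lower H Kn i.
have s0 i : 0 < s i := lt_le_trans svK1p (ssv i).
have [r [r0 rs Nr]] : exists r : R, [/\ 0 <= r,
    forall i, r < (2 * (1 - d) - 1) * s i &
    forall y : 'cV_n2, rdot (N *m y) (N *m y) <= r ^+ 2 * rdot y y].
  have dE : 2 * (1 - d) - 1 = 1 - 2 * d by ring.
  (* If [d < 0] the assumption does not separate [sv K] from [sv K.-1]; the least [s i] then serves
     as [r], because [1 - 2 * d > 1]. Otherwise it does, and [r] is [sv K]. *)
  rewrite dE; have [dn|dp] := ltP d 0.
    case: (@arg_minP _ _ _ (Ordinal K0) xpredT s isT) => i0 _ smin.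
    have [_ _ _ _ [_ _ Nb]] := H.
    exists (s i0); split => // [|i]; first exact: ltW.
    apply: le_lt_trans (smin i isT) _; have := s0 i; nra.
  exists (sv K); split => // [i|].
    by apply: lt_le_trans gap _; rewrite ler_pM2l.
  apply: (residual_sv_upper H Kn); apply: lt_le_trans gap _.
  by rewrite -[leRHS]mul1r ler_wpM2r //; lra.
apply: toC_inj; apply: (residual_uniqueness H H' _ r0 s0 rs Nr); first lra.
have rE : (\rank (X'' - X')%R <= 2 * K)%N.
  apply: leq_trans (mxrank_add _ _) _; rewrite mxrank_opp mul2n -addnn.
  exact: leq_add.
have := lower_ric_le A rE; rewrite !fnorm_sqr toCB -/d => /le_trans; apply.
have orth (Y M : 'M[R[i]]_(n1, n2)) : (Y ^t Num.conj)%sesqui *m M = 0 -> rdot Y M = 0.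
  by move=> YM; rewrite -[Y]mulmx1 rdotMl YM rdot0r.
have XN : rdot (toC X') N = 0 by apply/orth/(residual_orthogonal H).
have XN' : rdot (toC X'') N' = 0 by apply/orth/(residual_orthogonal H').
rewrite -[leLHS]/(rdot _ _) -Re_inner linearB /=.
(* The data term cancels: [N - N'] is the image of [X'' - X'] under the adjoint of [A] composed with
   [A]. *)
have -> : complex.Re (to_complex (inner (A X'' - A X') (A X'' - A X'))) =
   rdot (toC X'' - toC X') (N - N').
  rewrite Re_inner [X in rdot _ X]toCB rdotBr -[A X'' - A X']linearB.
  rewrite -!Re_inner !adjP !Re_inner.
  by rewrite /N /N' !toCB !(rdotBl, rdotBr); ring.
rewrite !(rdotBl, rdotBr) XN XN'.
rewrite [rdot (toC X'') N]rdotC [rdot (toC X') N']rdotC.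
lra.
Qed.
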